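(* Let $G$ be a Lie group (in Milnor's sense, modeled over a Hausdorff locally convex vector space). The following are equivalent: (i) $G$ is $0$-continuous; (ii) $G$ is locally $\mu$-convex; (iii) $G$ is $0.\infty$-continuous.
   Context: Calculus: for Hausdorff locally convex vector spaces $F,E$ and $U\subseteq F$ open, a map $f:U\to E$ is differentiable at $x$ if $D_vf(x)=\lim_{t\to 0}\frac1t(f(x+tv)-f(x))$ exists in $E$ for every $v\in F$; it is $C^0$ if continuous, $C^k$ ($k\ge 1$) if all iterated directional derivatives $D_{v_p}\cdots D_{v_1}f$ ($p\le k$) exist and $(x,v_1,\dots,v_p)\mapsto D_{v_p}\cdots D_{v_1}f(x)$ is continuous on $U\times F^p$ for $0\le p\le k$; $C^\infty$ (smooth) if $C^k$ for all $k$. $G$ is a Lie group in Milnor's sense: a group that is a smooth Hausdorff manifold (in this calculus) modeled on a Hausdorff locally convex vector space $E$, with smooth multiplication and inversion. $e$ is the unit, $\mathfrak g=T_eG$ the Lie algebra, $\mathrm R_g(h)=hg$. $\mathfrak P$ is the set of continuous seminorms on $E$. $\Xi:G\supseteq\mathcal U\to\mathcal V\subseteq E$ is a fixed chart with $e\in\mathcal U$, $\Xi(e)=0$, $\mathcal V$ convex. For $\mathfrak p\in\mathfrak P$ put $\dot{\mathfrak p}:=\mathfrak p\circ d_e\Xi$, a seminorm on $\mathfrak g$; these define the topology of $\mathfrak g$. A curve on a compact interval $[r,r']$ ($r<r'$) is $C^k$ if it is the restriction of a $C^k$-curve defined on an open interval containing $[r,r']$. The right logarithmic derivative of $\mu\in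 C^1([r,r'],G)$ is $\delta^r(\mu)(t)=d_{\mu(t)}\mathrm R_{\mu(t)^{-1}}(\dot\mu(t))$. Put $\mathfrak D_{[r,r']}:=\delta^r(C^1([r,r'],G))\subseteq C^0([r,r'],\mathfrak g)$ and $\mathfrak D^k_{[r,r']}:=\mathfrak D_{[r,r']}\cap C^k([r,r'],\mathfrak g)$. The map $\mathrm{evol}^k_{[r,r']}:\mathfrak D^k_{[r,r']}\to G$, $\delta^r(\mu)\mapsto\mu(r')\mu(r)^{-1}$, is well defined. For $k\in\{0,\infty\}$, $G$ is $0.k$-continuous if for every compact interval $[r,r']$ the map $\mathrm{evol}^k_{[r,r']}$ is continuous with respect to the topology on $\mathfrak D^k_{[r,r']}$ generated by the seminorms $\dot{\mathfrak p}_\infty(\phi)=\sup_{t\in[r,r']}\dot{\mathfrak p}(\phi(t))$, $\mathfrak p\in\mathfrak P$. $0$-continuous means $0.0$-continuous. $G$ is locally $\mu$-convex if for each $\mathfrak u\in\mathfrak P$ there exists $\mathfrak o\in\mathfrak P$ with $\mathfrak u\le\mathfrak o$ such that $(\mathfrak u\circ\Xi)(\Xi^{-1}(X_1)\cdots\Xi^{-1}(X_n))\le\mathfrak o(X_1)+\dots+\mathfrak o(X_n)$ for all $n\ge1$ and all $X_1,\dots,X_n\in E$ with $\mathfrak o(X_1)+\dots+\mathfrak o(X_n)\le1$ (the inequality includes that $X_i\in\mathcal V$ and that the product lies in $\mathcal U$). *)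

(* Defs.v *)
From HB Require Import structures.
From mathcomp Require Import all_boot all_order all_algebra.
From mathcomp Require Import all_classical all_reals all_analysis.

Set Implicit Arguments.
Unset Strict Implicit.
Unset Printing Implicit Defensive.

Import Order.TTheory GRing.Theory Num.Theory.
Import numFieldNormedType.Exports.

Local Open Scope classical_set_scope.
Local Open Scope ring_scope.

(** * Differential calculus between locally convex spaces

  [derive] and [derivable] of MathComp-Analysis are restricted to normed
  modules, hence the versions below. Maps are total; a map on an open set [U]
  is represented by any total extension, and nothing below depends on the
  values outside [U]. *)
Section Calculus.
Context {R : realType} {F E : tvsType R}.
Implicit Types (U : set F) (f : F -> E) (x v : F) (k : option nat).

Definition diff_quot f x v (t : R) : E := t^-1 *: (f (x + t *: v) - f x).

Definition ddiff f x v : Prop := exists l : E, diff_quot f x v t @[t --> 0^'] --> l.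

Definition dderiv v f : F -> E :=
  fun x => xget 0 [set l : E | diff_quot f x v t @[t --> 0^'] --> l].

(** [iter_dderiv f [:: v1; ...; vp]] is [D_{vp} ... D_{v1} f]. *)
Definition iter_dderiv f (vs : seq F) : F -> E :=
  foldl (fun g v => dderiv v g) f vs.

(** Differentiability orders: [Some n] is the order [n], [None] is infinity. *)
Definition leq_order (p : nat) k : bool := if k is Some n then (p <= n)%N else true.

(** The rows ['rV[F]_p] carry the product topology of [F^p]. *)
Definition Ck_on k U f : Prop :=
  (forall (vs : seq F) v x, leq_order (size vs).+1 k -> U x ->
     ddiff (iter_dderiv f vs) x v) /\
  (forall p, leq_order p k ->
     {within U `*` [set: 'rV[F]_p], continuous
       (fun z : F * 'rV[F]_p =>
          iter_dderiv f [seq z.2 ord0 i | i <- enum 'I_p] z.1)}).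

End Calculus.

(** * Manifolds modeled on locally convex spaces *)

(** [chart_inv] is the inverse on [chart_cod] of the chart, which is
  considered on [chart_dom] only. *)
Record chart (M E : Type) := Chart {
  chart_dom : set M;
  chart_cod : set E;
  chart_map :> M -> E;
  chart_inv : E -> M }.

Definition is_chart (M E : topologicalType) (c : chart M E) : Prop :=
  [/\ open (chart_dom c) /\ open (chart_cod c),
      forall x, chart_dom c x -> chart_cod c (c x) /\ chart_inv c (c x) = x,
      forall y, chart_cod c y ->
        chart_dom c (chart_inv c y) /\ c (chart_inv c y) = y,
      {within chart_dom c, continuous c} &
      {within chart_cod c, continuous (chart_inv c)}].

Definition prod_chart (M N E F : Type) (c : chart M E) (d : chart N F) :
    chart (M * N) (E * F) :=
  Chart (chart_dom c `*` chart_dom d) (chart_cod c `*` chart_cod d)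
        (fun z => (c z.1, d z.2)) (fun z => (chart_inv c z.1, chart_inv d z.2)).

Definition prod_atlas (M N E F : Type) (A : set (chart M E))
    (B : set (chart N F)) : set (chart (M * N) (E * F)) :=
  [set prod_chart c d | c in A & d in B].

Definition id_chart (E : Type) : chart E E := Chart setT setT id id.

(** The atlas through which a locally convex space is regarded as a manifold. *)
Definition model_atlas (E : Type) : set (chart E E) := [set @id_chart E].
Arguments model_atlas E : clear implicits.

Section Manifolds.
Context {R : realType}.

Definition compatible (M : Type) (E : tvsType R) (c d : chart M E) : Prop :=
  Ck_on None (chart_cod c `&` chart_inv c @^-1` chart_dom d)
    (d \o chart_inv c) /\
  Ck_on None (chart_cod d `&` chart_inv d @^-1` chart_dom c)
    (c \o chart_inv d).

(** A smooth structure is a maximal atlas. *)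
Definition smooth_structure (M : topologicalType) (E : tvsType R)
    (A : set (chart M E)) : Prop :=
  [/\ forall c, A c -> is_chart c,
      forall x, exists2 c, A c & chart_dom c x,
      forall c d, A c -> A d -> compatible c d &
      forall c, is_chart c -> (forall d, A d -> compatible c d) -> A c].

(** The map [f] is of class [C^k] on the open subset [O] of [M]. *)
Definition Ck_map (M N : topologicalType) (E F : tvsType R)
    (A : set (chart M E)) (B : set (chart N F)) (k : option nat) (O : set M)
    (f : M -> N) : Prop :=
  {within O, continuous f} /\
  forall c d, A c -> B d ->
    Ck_on k
      (chart_cod c `&` chart_inv c @^-1` (O `&` f @^-1` chart_dom d))
      (d \o f \o chart_inv c).

Definition Ck_curve (M : topologicalType) (E : tvsType R)
    (A : set (chart M E)) (k : option nat) (J : set R) (f : R -> M) : Prop :=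
  Ck_map (model_atlas R^o) A k (J : set R^o) (f : R^o -> M).

(** The total curves whose restriction to [[r, r']] is of class [C^k]; the
  elements of [C^k([r, r'], M)] are these restrictions. *)
Definition Ck_itv (M : topologicalType) (E : tvsType R)
    (A : set (chart M E)) (k : option nat) (r r' : R) : set (R -> M) :=
  [set f | exists J : set R,
     [/\ open J, is_interval J, [set` `[r, r']] `<=` J & Ck_curve A k J f]].

End Manifolds.

(** * Tangent vectors as equivalence classes of curves *)
Section Tangent.
Context {R : realType} {E : tvsType R} {M : topologicalType}.
Variable A : set (chart M E).
Implicit Types (g h : R -> M) (X : set (R -> M)).

Definition curve_deriv (f : R -> E) (t : R) : E :=
  dderiv (F := R^o) (1 : R^o) f t.

Definition C1_germ g : Prop :=
  exists2 e : R, 0 < e & Ck_curve A (Some 1%N) [set` `]-e, e[] g.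

Definition same_velocity g h : Prop :=
  g 0 = h 0 /\
  forall c, A c -> chart_dom c (g 0) ->
    curve_deriv (c \o g) 0 = curve_deriv (c \o h) 0.

Definition tangent_class g : set (R -> M) :=
  [set h | C1_germ h /\ same_velocity g h].

Definition velocity g (t : R) : set (R -> M) :=
  tangent_class (fun s => g (t + s)).

(** The differential [d_x c : T_x M -> E] of a chart [c] around [x]; all the
  curves in a tangent vector yield the same value. *)
Definition dchart (c : chart M E) X : E :=
  xget 0 [set curve_deriv (c \o g) 0 | g in X].

End Tangent.

Definition differential {R : realType} {F : tvsType R}
    {M N : topologicalType} (B : set (chart N F)) (f : M -> N)
    (X : set (R -> M)) : set (R -> N) :=
  \bigcup_(g in X) tangent_class B (f \o g).

(** * Lie groups *)

HB.mixin Record isLieGroup (R : realType) (E : tvsType R) G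
    of Topological G & Group G := {
  atlas : set (chart G E);
  lie_hausdorff : hausdorff_space G;
  lie_smooth_structure : smooth_structure atlas;
  lie_mul_smooth :
    Ck_map (prod_atlas atlas atlas) atlas None setT
      (fun z : G * G => (z.1 * z.2)%g);
  lie_inv_smooth : Ck_map atlas atlas None setT (fun x : G => (x^-1)%g)
}.

#[short(type="lieGroupType")]
HB.structure Definition LieGroup (R : realType) (E : tvsType R) :=
  {G of isLieGroup R E G & Topological G & Group G}.

Definition continuous_seminorm {R : realType} {E : tvsType R} (p : E -> R) : Prop :=
  [/\ forall x y, p (x + y) <= p x + p y,
      forall (a : R) x, p (a *: x) = `|a| * p x &
      continuous p].

Section LieGroupTheory.
Context {R : realType} {E : tvsType R} {G : lieGroupType E}.

Definition right_translation (g h : G) : G := (h * g)%g.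

Definition right_log_deriv (mu : R -> G) (t : R) : set (R -> G) :=
  differential (atlas : set (chart G E)) (right_translation (mu t)^-1%g)
    (velocity (atlas : set (chart G E)) mu t).

Definition itv_type (r r' : R) := {t : R | t \in `[r, r']}.

Definition log_deriv_of (r r' : R) (mu : R -> G) (phi : itv_type r r' -> set (R -> G))
    : Prop :=
  Ck_itv (atlas : set (chart G E)) (Some 1%N) r r' mu /\
  forall t, phi t = right_log_deriv mu (val t).

Variable Xi : chart G E.

(** The topological vector space structure of the Lie algebra [T_e G] is the
  one which makes [d_e Xi : T_e G -> E] an isomorphism; curves in [T_e G] are
  accordingly differentiated, subtracted and measured through [d_e Xi]. *)
Definition lie_coord (r r' : R) (phi : itv_type r r' -> set (R -> G)) :
  itv_type r r' -> E := fun t => dchart Xi (phi t).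

(** The set of the [delta^r(mu)] on [[r, r']], [mu] of class [C^1], which are of
  class [C^k] as curves in the Lie algebra. *)
Record evol_domain (k : option nat) (r r' : R) := EvolDomain {
  evol_curve :> itv_type r r' -> set (R -> G);
  evol_curve_log : exists mu, log_deriv_of mu evol_curve;
  evol_curve_Ck : exists2 f, Ck_itv (model_atlas E) k r r' f &
    forall t, lie_coord evol_curve t = f (val t) }.

HB.instance Definition _ (k : option nat) (r r' : R) :=
  gen_eqMixin (evol_domain k r r').
HB.instance Definition _ (k : option nat) (r r' : R) :=
  gen_choiceMixin (evol_domain k r r').

Definition sup_seminorm (p : E -> R) (r r' : R) (f : itv_type r r' -> E) : R :=
  sup [set p (f t) | t in [set: itv_type r r']].

Definition seminorm_ball (k : option nat) (r r' : R) (p : E -> R)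
    (phi : evol_domain k r r') (eps : R) : set (evol_domain k r r') :=
  [set psi | sup_seminorm p (fun t => lie_coord psi t - lie_coord phi t) < eps].

Definition seminorm_balls (k : option nat) (r r' : R) :
    set (set (evol_domain k r r')) :=
  [set B | exists p phi eps,
     [/\ continuous_seminorm p, 0 < eps & B = seminorm_ball p phi eps]].

(** The topology generated by the seminorms: their balls form a subbasis. *)
HB.instance Definition _ (k : option nat) (r r' : R) :=
  isSubBaseTopological.Build (evol_domain k r r') (@seminorm_balls k r r') id.

(** [mu r' * (mu r)^-1] does not depend on the choice of [mu]; the default
  value [1] is never used on [evol_domain]. *)
Definition evol (k : option nat) (r r' : R) (phi : evol_domain k r r') : G :=
  xget 1%g [set (mu r' * (mu r)^-1)%g | mu in [set mu | log_deriv_of mu phi]].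

Definition zero_k_continuous (k : option nat) : Prop :=
  forall r r' : R, r < r' -> continuous (@evol k r r').

Definition locally_mu_convex : Prop :=
  forall u : E -> R, continuous_seminorm u ->
  exists o : E -> R,
    [/\ continuous_seminorm o, forall x, u x <= o x &
        forall (n : nat) (X : 'I_n -> E), (0 < n)%N ->
          \sum_(i < n) o (X i) <= 1 ->
          [/\ forall i, chart_cod Xi (X i),
              chart_dom Xi (\prod_(i < n) chart_inv Xi (X i))%g &
              u (Xi (\prod_(i < n) chart_inv Xi (X i))%g)
                <= \sum_(i < n) o (X i)]].

End LieGroupTheory.

Arguments zero_k_continuous {R E G} Xi k.
Arguments locally_mu_convex {R E G} Xi.

(* Main.v *)
Require Import Defs.
From mathcomp Require Import all_boot all_order all_algebra.
From mathcomp Require Import all_classical all_reals all_analysis.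
From mathcomp Require Import lra ring.

Set Implicit Arguments.
Unset Strict Implicit.
Unset Printing Implicit Defensive.

Import Order.TTheory GRing.Theory Num.Theory.
Import numFieldNormedType.Exports.
Local Open Scope classical_set_scope.
Local Open Scope ring_scope.

(** The three properties are linked by two implications, valid for each class [k]
  of curves in the Lie algebra: local mu-convexity implies the continuity of the
  evolution map on curves of class [k] ([convex_continuous]), and the latter
  implies local mu-convexity ([continuous_convex]). Taking [k] to be zero or
  infinity closes the circle.

  From convexity to continuity: let [mu] and [nu] be two motions whose logarithmic
  derivatives [phi] and [psi] are uniformly close. The quotient [mu^-1 * nu] moves,
  in a short time [h] around [t], by a factor [g^-1 * (a^-1 * b) * g], where
  [g = mu t] and [a], [b] are the increments of [mu] and [nu]. This factor is
  trivial for [a = b], so the mean value theorem bounds its image in the chart by a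
  seminorm of the difference of the images of [a] and [b]
  ([conj_quotient_lipschitz]), that is, to first order, of [h * (psi t - phi t)].
  Subdividing the interval, the total motion of the quotient is a product of chart
  images of vectors with small total length ([quotient_factorization]), which is
  what local mu-convexity controls. The estimate holds
  near each single point, and a covering argument on the interval ([chain_local])
  provides the subdivision.

  From continuity to convexity: a product of chart images of short vectors is the
  end point of a smooth motion which runs through the rays of the factors one after
  the other, slowed down by a smooth step function so that it stops in between
  ([reached_product]). Allotting to each ray a time proportional to its length
  makes the logarithmic derivative uniformly small. As the end point is determined
  by the logarithmic derivative ([evolE]), continuity of the evolution map at the
  constant motion confines all these products to a given neighborhood of the unit
  ([continuous_small_products]). There the multiplication is Lipschitz, so adding
  one factor changes the image of the product in the chart by at most a seminorm of
  that factor, and these changes add up to the required bound.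

  On the analytic side, the continuous seminorms generate the topology by local
  convexity ([nbhs0_seminorm]), and a map of class C1 is locally Lipschitz with
  respect to them ([C1_lipschitz]). The maximality of the atlas provides charts
  composed with the inversion and with right translations ([inv_chart_atlas],
  [translated_chart_atlas]). *)

(** * Continuous seminorms *)

Section Seminorms.
Context {R : realType} {E : tvsType R}.
Implicit Types (p q : E -> R) (x y : E) (B C : set E).

Lemma seminorm_add p x y : continuous_seminorm p -> p (x + y) <= p x + p y.
Proof. by case. Qed.

Lemma seminormZ p (a : R) x : continuous_seminorm p -> p (a *: x) = `|a| * p x.
Proof. by case. Qed.

Lemma seminorm0 p : continuous_seminorm p -> p 0 = 0.
Proof. by move=> hp; rewrite -(scale0r 0) seminormZ// normr0 mul0r. Qed.

Lemma seminormN p x : continuous_seminorm p -> p (- x) = p x.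
Proof. by move=> hp; rewrite -scaleN1r seminormZ// normrN1 mul1r. Qed.

Lemma seminorm_ge0 p x : continuous_seminorm p -> 0 <= p x.
Proof.
move=> hp; have := seminorm_add x (- x) hp.
by rewrite subrr seminorm0// seminormN// -mulr2n pmulrn_lge0.
Qed.

Lemma seminormBC p x y : continuous_seminorm p -> p (x - y) = p (y - x).
Proof. by move=> hp; rewrite -opprB seminormN. Qed.

Lemma seminorm_sub p x y z : continuous_seminorm p ->
  p (x - z) <= p (x - y) + p (y - z).
Proof.
by move=> hp; rewrite -[in leLHS](subrK y x) -addrA; exact: seminorm_add.
Qed.

Lemma seminorm_le_sub p x y : continuous_seminorm p -> p x <= p y + p (x - y).
Proof. by move=> hp; rewrite -[in leLHS](subrK y x) addrC; exact: seminorm_add. Qed.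

Lemma seminorm_nbhs p x (e : R) : continuous_seminorm p -> 0 < e ->
  nbhs x [set y | p (y - x) < e].
Proof.
move=> hp e0.
have [_ _ pc] := hp.
have : continuous (fun y => p (y - x)).
  move=> y; apply: (@continuous_comp _ _ _ (fun y => y - x) p); last exact: pc.
  apply: (@continuous_comp _ _ _ (fun y => (y, x)) (fun z : E * E => z.1 - z.2)).
    by apply: cvg_pair; [exact: cvg_id|exact: cvg_cst].
  exact: sub_continuous.
move=> /(_ x); rewrite /continuous_at subrr seminorm0// => /cvgr_lt/(_ e e0).
by [].
Qed.

Lemma seminorm_nbhs0 p (e : R) : continuous_seminorm p -> 0 < e ->
  nbhs 0 [set y | p y < e].
Proof.
move=> hp e0; have := seminorm_nbhs 0 hp e0.
by apply: filterS => y /=; rewrite subr0.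
Qed.

Lemma nbhs_addr x B : nbhs x B -> nbhs 0 [set y | B (x + y)].
Proof.
move=> xB; have : continuous (fun y => x + y).
  move=> y; apply: (@continuous_comp _ _ _ (fun y => (x, y)) (fun z : E * E => z.1 + z.2)).
    by apply: cvg_pair; [exact: cvg_cst|exact: cvg_id].
  exact: add_continuous.
by move=> /(_ 0 B) /=; rewrite addr0 => /(_ xB).
Qed.

Lemma nbhs0_scale (a : R) B : nbhs 0 B -> nbhs 0 [set x | B (a *: x)].
Proof.
move=> B0; have : continuous (fun x : E => a *: x).
  move=> x; apply: (@continuous_comp _ _ _ (fun x => (a, x) : R^o * E)
    (fun z : R^o * E => z.1 *: z.2)).
    by apply: (@cvg_pair _ _ _ _ (nbhs (a : R^o))); [exact: cvg_cst|exact: cvg_id].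
  exact: scale_continuous.
by move=> /(_ 0 B); rewrite /= scaler0 => /(_ B0).
Qed.

Lemma scale_nbhs0 x B : nbhs 0 B -> exists2 e : R, 0 < e &
  forall s, `|s| < e -> B (s *: x).
Proof.
move=> B0; have : continuous (fun a : R^o => a *: x).
  move=> a; apply: (@continuous_comp _ _ _ (fun a => (a, x) : R^o * E)
    (fun z : R^o * E => z.1 *: z.2)).
    by apply: (@cvg_pair _ _ _ _ (nbhs (a : R^o))); [exact: cvg_id|exact: cvg_cst].
  exact: scale_continuous.
move=> /(_ 0 B); rewrite /= scale0r => /(_ B0) /nbhs_ballP [e /= e0 eB].
exists e => // s se; apply: eB => /=.
by rewrite /ball/= sub0r normrN.
Qed.

(** Homogeneity turns the bound near the origin into continuity there, and the
  triangle inequality transports it to every point. *)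
Lemma bounded_seminorm_continuous p :
  (forall x y, p (x + y) <= p x + p y) ->
  (forall (a : R) x, p (a *: x) = `|a| * p x) ->
  nbhs 0 [set x | p x <= 1] -> continuous_seminorm p.
Proof.
move=> pD pZ p1; split => // x.
have pN y : p (- y) = p y by rewrite -scaleN1r pZ normrN1 mul1r.
apply/cvgrPdist_le => /= e e0.
have := nbhs0_scale e^-1 p1.
have : continuous (fun y => y - x).
  move=> y; apply: (@continuous_comp _ _ _ (fun y => (y, x)) (fun z : E * E => z.1 - z.2)).
    by apply: cvg_pair; [exact: cvg_id|exact: cvg_cst].
  exact: sub_continuous.
move=> /(_ x); rewrite /continuous_at subrr => cx /cx xp.
near=> y; have : p (e^-1 *: (y - x)) <= 1 by near: y.
rewrite pZ gtr0_norm ?invr_gt0// ler_pdivrMl// mulr1 => pe.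
rewrite ler_norml; apply/andP; split.
  rewrite lerNl opprB lerBlDr; apply: le_trans (lerD pe (lexx _)).
  by rewrite -[in leLHS](subrK x y).
rewrite lerBlDr; apply: le_trans (lerD pe (lexx _)).
by rewrite -(pN (y - x)) opprB -[in leLHS](subrK y x).
Unshelve. all: by end_near. Qed.

Lemma seminormD p q : continuous_seminorm p -> continuous_seminorm q ->
  continuous_seminorm (fun x => p x + q x).
Proof.
move=> hp hq; apply: bounded_seminorm_continuous => [x y|a x|].
- by rewrite addrACA lerD// seminorm_add.
- by rewrite !seminormZ// mulrDr.
have h2 : (0 : R) < 2^-1 by rewrite invr_gt0.
have := seminorm_nbhs0 hp h2; have := seminorm_nbhs0 hq h2.
apply: filterS2 => x /= q1 p1.
by rewrite [leRHS]splitr div1r lerD// ltW.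
Qed.

Lemma seminorm_scale p (a : R) : 0 <= a -> continuous_seminorm p ->
  continuous_seminorm (fun x => a * p x).
Proof.
move=> a0 hp; apply: bounded_seminorm_continuous => [x y|b x|].
- by rewrite -mulrDr ler_wpM2l// seminorm_add.
- by rewrite seminormZ// mulrCA.
have a1 : 0 < (a + 1)^-1 by rewrite invr_gt0 ltr_wpDl.
apply: filterS (seminorm_nbhs0 hp a1) => x /= /ltW px.
apply: le_trans (ler_wpM2l a0 px) _.
by rewrite ler_pdivrMr ?mul1r ?lerDl// ltr_wpDl.
Qed.

Lemma zero_seminorm : continuous_seminorm (fun _ : E => 0 : R).
Proof. by split => [x y|a x|x]; rewrite ?addr0 ?mulr0//; exact: cst_continuous. Qed.

Section Gauge.
Variable C : set E.
Hypothesis Cconv : forall x y (s : R), 0 <= s <= 1 -> C x -> C y ->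
  C (s *: x + (1 - s) *: y).
Hypothesis Csym : forall x, C x -> C (- x).
Hypothesis C0 : nbhs 0 C.

Let dilations x := [set t : R | 0 < t /\ C (t^-1 *: x)].

Definition gauge_of x : R := inf (dilations x).

Let gauge_inf x : has_inf (dilations x).
Proof.
split; last by exists 0 => t [/ltW].
have [e e0 eC] := scale_nbhs0 x C0.
exists (2 / e); split; first by rewrite divr_gt0.
apply: eC; rewrite invf_div gtr0_norm ?divr_gt0//.
by rewrite ltr_pdivrMr// ltr_pMr// ltr1n.
Qed.

Let Cscale x (s : R) : 0 <= s <= 1 -> C x -> C (s *: x).
Proof.
move=> s01 Cx; have := Cconv s01 Cx (nbhs_singleton C0).
by rewrite scaler0 addr0.
Qed.

Let gauge_le x t : 0 < t -> C (t^-1 *: x) -> gauge_of x <= t.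
Proof. by move=> t0 Ct; apply: ge_inf => //; exists 0 => s [/ltW]. Qed.

Let gauge_lt x t : gauge_of x < t -> 0 < t /\ C (t^-1 *: x).
Proof.
move=> gt; have e0 : 0 < t - gauge_of x by rewrite subr_gt0.
have [s [s0 Cs]] := inf_adherent e0 (gauge_inf x).
rewrite addrC subrK => st; have t0 := lt_trans s0 st; split => //.
have -> : t^-1 *: x = (s / t) *: (s^-1 *: x).
  by rewrite scalerA mulrAC divff ?mul1r// gt_eqF.
apply: Cscale => //; rewrite divr_ge0 ?ltW//= ltr_pdivrMr// mul1r.
exact: st.
Qed.

Let gauge_ge0 x : 0 <= gauge_of x.
Proof. by apply: lb_le_inf; [exact: (gauge_inf x).1|move=> t [/ltW]]. Qed.

Let gaugeZ_le (a : R) x : a != 0 -> gauge_of (a *: x) <= `|a| * gauge_of x.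
Proof.
move=> a0; have na : 0 < `|a| by rewrite normr_gt0.
rewrite -ler_pdivrMl//; apply/ler_addgt0Pr => e e0.
have [] := @gauge_lt x (gauge_of x + e); first by rewrite ltrDl.
set t := gauge_of x + e => t0 Ct.
rewrite ler_pdivrMl//; apply: gauge_le; first by rewrite mulr_gt0.
have -> : (`|a| * t)^-1 *: (a *: x) = (a / `|a|) *: (t^-1 *: x).
  by rewrite !scalerA invfM; congr (_ *: _); ring.
have [a1|a1|a1] := ltgtP 0 a.
- by rewrite gtr0_norm// divff// scale1r.
- rewrite ltr0_norm// invrN mulrN divff// scaleN1r.
  exact: Csym.
- by rewrite -a1 eqxx in a0.
Qed.

Lemma gauge_seminorm : continuous_seminorm gauge_of.
Proof.
apply: bounded_seminorm_continuous.
- move=> x y; apply/ler_addgt0Pr => e e0.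
  have e2 : 0 < e / 2 by rewrite divr_gt0.
  have [] := @gauge_lt x (gauge_of x + e / 2); first by rewrite ltrDl.
  have [] := @gauge_lt y (gauge_of y + e / 2); first by rewrite ltrDl.
  set t := gauge_of x + _; set s := gauge_of y + _ => s0 Cs t0 Ct.
  have -> : gauge_of x + gauge_of y + e = t + s.
    by rewrite /t /s addrACA -splitr.
  have ts : 0 < t + s by rewrite addr_gt0.
  apply: gauge_le => //.
  have -> : (t + s)^-1 *: (x + y) =
    (t / (t + s)) *: (t^-1 *: x) + (1 - t / (t + s)) *: (s^-1 *: y).
    rewrite !scalerA mulrAC mulfV ?gt_eqF// mul1r scalerDr; congr (_ + _ *: _).
    have -> : 1 - t / (t + s) = s / (t + s).
      by rewrite -[X in X - _](@mulfV _ (t + s)) ?gt_eqF// -mulrBl addrAC subrr add0r.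
    by rewrite mulrAC mulfV ?gt_eqF// mul1r.
  by apply: Cconv => //; rewrite divr_ge0 ?ltW//= ltr_pdivrMr// mul1r ltrDl.
- move=> a x; have [->|a0] := eqVneq a 0; last first.
    apply/le_anti; rewrite gaugeZ_le//=.
    have ai : a^-1 != 0 by rewrite invr_eq0.
    have := gaugeZ_le (a *: x) ai; rewrite scalerA mulVf// scale1r normfV.
    by rewrite -ler_pdivrMl ?invr_gt0 ?normr_gt0// invrK.
  rewrite scale0r normr0 mul0r; apply/le_anti; rewrite gauge_ge0 andbT.
  apply/ler_addgt0Pr => e e0; rewrite add0r; apply: gauge_le => //.
  by rewrite scaler0; exact: nbhs_singleton C0.
- by apply: filterS C0 => x Cx /=; apply: gauge_le => //; rewrite invr1 scale1r.
Qed.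

Lemma gauge_lt1 x : gauge_of x < 1 -> C x.
Proof. by move=> /gauge_lt [_]; rewrite invr1 scale1r. Qed.

End Gauge.

(** Local convexity: the gauge of a symmetric convex neighborhood contained in
  [B] is such a seminorm. *)
Lemma nbhs0_seminorm B : nbhs 0 B ->
  exists2 p, continuous_seminorm p & forall x, p x < 1 -> B x.
Proof.
move=> B0.
have [D Dconv [Dop Dbas]] := @locally_convex R E.
have [V [DV V0] VB] := Dbas 0 B B0.
have oV := Dop _ DV.
pose C := [set x | V x /\ V (- x)].
have nV : nbhs 0 V by apply: open_nbhs_nbhs.
have C0 : nbhs 0 C.
  have := nbhs0_scale (-1) nV.
  by apply: filterS2 nV => x /= Vx; rewrite scaleN1r.
have Vconv x y (s : R) : 0 <= s <= 1 -> V x -> V y -> V (s *: x + (1 - s) *: y).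
  move=> /andP[s0 s1] Vx Vy.
  have /convex_setW := Dconv _ (mem_set DV).
  move=> cV.
  have [->|sn0] := eqVneq s 0; first by rewrite scale0r subr0 scale1r add0r.
  have [->|sn1] := eqVneq s 1; first by rewrite scale1r subrr scale0r addr0.
  have s01 : Itv.spec (@Itv.num_sem R) (Itv.Real `[0%Z, 1%Z]) s.
    by rewrite /= /Itv.num_sem/= in_itv/= num_real/= s0 s1.
  have := cV x y (mem_set Vx) (mem_set Vy) (Itv.mk s01); rewrite inE; apply => /=.
    by rewrite lt_neqAle eq_sym sn0.
  by rewrite lt_neqAle sn1.
exists (gauge_of C); last first.
  move=> x h; apply: VB; apply: (gauge_lt1 _ _ h).1; last exact: C0.
  move=> {h} a b s s01 [Va VNa] [Vb VNb]; split; first exact: Vconv.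
  by rewrite opprD -!scalerN; exact: Vconv.
apply: gauge_seminorm => //.
  move=> a b s s01 [Va VNa] [Vb VNb]; split; first exact: Vconv.
  by rewrite opprD -!scalerN; exact: Vconv.
by move=> x [Vx VNx]; split => //; rewrite opprK.
Qed.

Lemma nbhs_seminorm x B : nbhs x B ->
  exists2 p, continuous_seminorm p & forall y, p (y - x) < 1 -> B y.
Proof.
move=> /nbhs_addr /nbhs0_seminorm [p hp pB]; exists p => // y /pB /=.
by rewrite addrC subrK.
Qed.

Lemma seminorm_separated x : hausdorff_space E ->
  (forall p, continuous_seminorm p -> p x = 0) -> x = 0.
Proof.
move=> hE px; apply: hE => A B xA B0.
have [p hp pB] := nbhs0_seminorm B0.
by exists x; split; [exact: nbhs_singleton xA|apply: pB; rewrite px].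
Qed.

End Seminorms.
(** * Chaining local estimates along an interval *)

(** Cousin's covering principle, for a relation between the endpoints of
  subintervals; compactness, mean value estimates and factorizations along a
  subdivision are all drawn from it. *)
Lemma chain_local {R : realType} (P : R -> R -> Prop) (r r' : R) : r <= r' ->
  (forall a b c, r <= a -> a <= b -> b <= c -> c <= r' -> P a b -> P b c -> P a c) ->
  (forall t, r <= t <= r' -> exists2 d : R, 0 < d &
     forall s, r <= s <= r' -> `|s - t| < d ->
       (s <= t -> P s t) /\ (t <= s -> P t s)) ->
  P r r'.
Proof.
move=> rr' Ptrans Ploc.
have Prr t : r <= t <= r' -> P t t.
  move=> /[dup] ht /Ploc [d d0 /(_ t ht)]; rewrite subrr normr0 => /(_ d0) [].
  by move=> /(_ (lexx _)).
pose S := [set t | r <= t <= r' /\ P r t].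
have Sr : S r by split; [rewrite lexx|apply: Prr; rewrite lexx].
have supS : has_sup S by split; [exists r|exists r' => t [/andP[]]].
pose c := sup S.
have rc : r <= c by apply: ub_le_sup => //; exact: supS.2.
have cr' : c <= r' by apply: ge_sup => [|t [/andP[]]//]; exact: supS.1.
have [d d0 hd] : exists2 d : R, 0 < d &
    forall s, r <= s <= r' -> `|s - c| < d -> (s <= c -> P s c) /\ (c <= s -> P c s).
  by apply: Ploc; rewrite rc.
have [s [/andP[rs sr'] Prs] cds] := sup_adherent d0 supS.
have sc : s <= c by apply: ub_le_sup; [exact: supS.2|split=> //; apply/andP].
have Prc : P r c.
  apply: (Ptrans r s c) => //; apply: (hd s _ _).1 => //; first exact/andP.
  by rewrite distrC ger0_norm ?subr_ge0// ltrBlDr -ltrBlDl.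
have [r'c|cr] := leP r' c; first by have <- : c = r' by apply/le_anti/andP.
pose s' := Num.min r' (c + d / 2).
have d2 : 0 < d / 2 by rewrite divr_gt0.
have cs' : c < s' by rewrite lt_min cr ltrDl.
have s'r : s' <= r' by rewrite ge_min lexx.
have Prs' : P r s'.
  apply: (Ptrans r c s') => //; first exact: ltW.
  apply: (hd s' _ _).2; rewrite ?(ltW cs')//.
    by rewrite s'r (le_trans rc)// ltW.
  rewrite ger0_norm ?subr_ge0 ?(ltW cs')// ltrBlDl gt_min; apply/orP; right.
  by rewrite ltrD2l ltr_pdivrMr// ltr_pMr// ltr1n.
suff : s' <= c by rewrite leNgt cs'.
apply: ub_le_sup; first exact: supS.2.
by split => //; rewrite s'r (le_trans rc)// ltW.
Qed.

Lemma chain_near {R : realType} (P : R -> R -> Prop) (r r' : R) : r <= r' ->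
  (forall a b c, r <= a -> a <= b -> b <= c -> c <= r' -> P a b -> P b c -> P a c) ->
  (forall t, r <= t <= r' -> \forall s \near (0 : R), r <= t + s <= r' ->
       (s <= 0 -> P (t + s) t) /\ (0 <= s -> P t (t + s))) ->
  P r r'.
Proof.
move=> rr' Ptrans Ploc; apply: chain_local => // t /Ploc /nbhs_ballP [d /= d0 hd].
exists d => // s srr' sd.
have := hd (s - t); rewrite /ball/= sub0r normrN => /(_ sd).
by rewrite addrC subrK subr_le0 subr_ge0; apply.
Qed.

(** * Derivatives of curves through seminorms *)

Section CurveDerivative.
Context {R : realType} {E : tvsType R}.
Implicit Types (f g : R -> E) (u : E -> R) (t : R) (l : E).

(** Convergence of the difference quotients to [l], tested on the seminorms, which
  generate the topology; in this form derivatives are handled by estimates. *)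
Definition has_deriv f t l := forall u, continuous_seminorm u ->
  forall e : R, 0 < e -> \forall s \near (0 : R),
    u (f (t + s) - f t - s *: l) <= e * `|s|.

Lemma has_deriv_cvgP f t l :
  has_deriv f t l <-> s^-1 *: (f (t + s) - f t) @[s --> (0 : R)^'] --> l.
Proof.
have key u (s : R) : continuous_seminorm u -> s != 0 ->
    u (f (t + s) - f t - s *: l) = `|s| * u (s^-1 *: (f (t + s) - f t) - l).
  move=> hu s0; rewrite -seminormZ//; congr u.
  by rewrite scalerBr scalerA divff// scale1r.
split=> [fl B /nbhs_seminorm [u hu uB]|fl u hu e e0].
  have e2 : (0 : R) < 2^-1 by rewrite invr_gt0.
  rewrite /= /dnbhs /within /=; apply: filterS (fl u hu _ e2) => s hs s0.
  apply: uB; move: hs; rewrite key// mulrC ler_pM2r ?normr_gt0// => /le_lt_trans; apply.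
  by rewrite invf_lt1// ltr1n.
have : \forall s \near (0 : R), s != 0 -> u (s^-1 *: (f (t + s) - f t) - l) < e.
  exact: (fl _ (seminorm_nbhs l hu e0)).
apply: filterS => s hs.
have [->|s0] := eqVneq s 0.
  by rewrite addr0 subrr scale0r subrr seminorm0// normr0 mulr0.
by rewrite key// mulrC ler_pM2r ?normr_gt0// ltW// hs.
Qed.

Lemma has_deriv_unique f t l l' : hausdorff_space E ->
  has_deriv f t l -> has_deriv f t l' -> l = l'.
Proof. by move=> hE /has_deriv_cvgP fl /has_deriv_cvgP; apply: cvg_unique. Qed.

Lemma has_deriv_shift f t l : has_deriv f t l <-> has_deriv (fun s => f (t + s)) 0 l.
Proof.
by split=> h u hu e e0; have := h u hu e e0; apply: filterS => s /=;
  rewrite ?add0r ?addr0.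
Qed.

Lemma has_deriv_near f g t l : (\forall s \near (0 : R), f (t + s) = g (t + s)) ->
  has_deriv f t l -> has_deriv g t l.
Proof.
move=> fg h u hu e e0; have fgt := nbhs_singleton fg; rewrite addr0 in fgt.
by have := h u hu e e0; apply: filterS2 fg => s -> ; rewrite fgt.
Qed.

Lemma has_deriv_cst t (c : E) : has_deriv (fun _ => c) t 0.
Proof.
move=> u hu e e0; near=> s.
by rewrite subrr scaler0 subrr seminorm0// mulr_ge0// ltW.
Unshelve. all: by end_near. Qed.

Lemma has_deriv_line t (c v : E) : has_deriv (fun s => c + s *: v) t v.
Proof.
move=> u hu e e0; near=> s.
have -> : c + (t + s) *: v - (c + t *: v) - s *: v = 0.
  by rewrite scalerDl addrA [X in X - _]addrAC subrr add0r subrr.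
by rewrite seminorm0// mulr_ge0// ltW.
Unshelve. all: by end_near. Qed.

Lemma near0_normlt (e : R) : 0 < e -> \forall s \near (0 : R), `|s| < e.
Proof.
move=> e0; have : nbhs (0 : R) (ball (0 : R) e) by exact: nbhsx_ballx.
by apply: filterS => s; rewrite /ball/= sub0r normrN.
Qed.

Lemma has_deriv_le f t l u (K : R) : continuous_seminorm u -> u l < K ->
  has_deriv f t l -> \forall s \near (0 : R), u (f (t + s) - f t) <= K * `|s|.
Proof.
move=> hu uK /(_ u hu (K - u l)); rewrite subr_gt0 => /(_ uK).
apply: filterS => s hs; apply: le_trans (seminorm_le_sub _ (s *: l) hu) _.
by rewrite seminormZ// mulrC -lerBrDl -mulrBl.
Qed.

Lemma has_deriv_small f t l u (e : R) : continuous_seminorm u -> 0 < e ->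
  has_deriv f t l -> \forall s \near (0 : R), u (f (t + s) - f t) < e.
Proof.
move=> hu e0 fl; have uK : u l < u l + 1 by rewrite ltrDl.
have K0 : 0 < u l + 1 by rewrite ltr_wpDl// seminorm_ge0.
have := near0_normlt (divr_gt0 e0 K0).
apply: filterS2 (has_deriv_le hu uK fl) => s h1 h2.
by apply: le_lt_trans h1 _; rewrite mulrC -ltr_pdivlMr.
Qed.

Lemma has_derivD f g t l l' : has_deriv f t l -> has_deriv g t l' ->
  has_deriv (fun s => f s + g s) t (l + l').
Proof.
move=> fl gl u hu e e0; have e2 : 0 < e / 2 by rewrite divr_gt0.
apply: filterS2 (fl u hu _ e2) (gl u hu _ e2) => s h1 h2.
have -> : f (t + s) + g (t + s) - (f t + g t) - s *: (l + l') =
  (f (t + s) - f t - s *: l) + (g (t + s) - g t - s *: l').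
  by rewrite [RHS]addrACA [X in _ = X + _]addrACA scalerDr !opprD.
apply: le_trans (seminorm_add _ _ hu) _.
by apply: le_trans (lerD h1 h2) _; rewrite -mulrDl -splitr.
Qed.

Lemma has_derivB f g t l l' : has_deriv f t l -> has_deriv g t l' ->
  has_deriv (fun s => f s - g s) t (l - l').
Proof.
move=> fl gl; apply: has_derivD fl _ => u hu e e0.
have := gl u hu e e0; apply: filterS => s.
by rewrite -(seminormN _ hu) scalerN !opprD !opprK.
Qed.

(** Mean value estimate: local Lipschitz bounds at each point of an interval
  chain into a global one. *)
Lemma mean_value_seminorm u f (a b K : R) : continuous_seminorm u -> a <= b ->
  (forall t, a <= t <= b -> \forall s \near (0 : R), a <= t + s <= b ->
     u (f (t + s) - f t) <= K * `|s|) ->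
  u (f b - f a) <= K * (b - a).
Proof.
move=> hu ab floc.
apply: (@chain_near _ (fun x y => u (f y - f x) <= K * (y - x))) => //.
  move=> x y z ax xy yz zb h1 h2.
  have -> : K * (z - x) = K * (z - y) + K * (y - x) by ring.
  by apply: le_trans (seminorm_sub _ (f y) _ hu) _; rewrite lerD.
move=> t /floc; apply: filterS => s h /h{h}; split=> s0.
  by rewrite seminormBC// opprD addrA subrr add0r -(ler0_norm s0).
by have -> : t + s - t = `|s| by rewrite ger0_norm//; ring.
Qed.

Lemma mean_value f (f' : R -> E) u (a b K : R) : continuous_seminorm u -> a <= b ->
  (forall t, a <= t <= b -> has_deriv f t (f' t)) ->
  (forall t, a <= t <= b -> u (f' t) <= K) ->
  u (f b - f a) <= K * (b - a).
Proof.
move=> hu ab fd fK; have [<-|nab] := eqVneq a b.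
  by rewrite !subrr seminorm0// mulr0.
have ba : 0 < b - a by rewrite subr_gt0 lt_neqAle nab.
rewrite -ler_pdivrMr//; apply/ler_addgt0Pr => e e0; rewrite ler_pdivrMr//.
apply: (mean_value_seminorm hu ab) => t tab.
have Kt : u (f' t) < K + e by rewrite (le_lt_trans (fK t tab))// ltrDl.
by apply: filterS (has_deriv_le hu Kt (fd t tab)) => s.
Qed.

End CurveDerivative.

Section Calculus1.
Context {R : realType} {E : tvsType R}.

Lemma norm_seminorm : continuous_seminorm (fun x : R^o => `|x| : R).
Proof.
split => [x y|a x|x]; first exact: ler_normD.
  by rewrite /GRing.scale/= normrM.
exact: (@norm_continuous _ R^o).
Qed.

Lemma seminorm_scalar (u : R^o -> R) (x : R^o) : continuous_seminorm u ->
  u x = `|x| * u 1.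
Proof. by move=> hu; rewrite -seminormZ// /GRing.scale/= mulr1. Qed.

Lemma has_deriv_realP (f : R -> R) (t l : R) : has_deriv (E := R^o) f t l <->
  forall e : R, 0 < e -> \forall s \near (0 : R),
    `|f (t + s) - f t - s * l| <= e * `|s|.
Proof.
split=> [h e e0|h u hu e e0]; first exact: (h _ norm_seminorm).
have K : 0 < u 1 + 1 by rewrite ltr_wpDl// seminorm_ge0.
apply: filterS (h _ (divr_gt0 e0 K)) => s hs.
rewrite seminorm_scalar//.
apply: le_trans (_ : _ <= `|f (t + s) - f t - s * l| * (u 1 + 1)) _.
  by rewrite ler_wpM2l// lerDl.
by rewrite -ler_pdivlMr// mulrAC.
Qed.

Lemma has_deriv_scale (a : R -> R) (g : R -> E) (t a' : R) (l : E) :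
  has_deriv (E := R^o) a t a' -> has_deriv g t l ->
  has_deriv (fun s => a s *: g s) t (a' *: g t + a t *: l).
Proof.
move=> ha hg u hu e e0.
have G0 : 0 < u (g t) + 1 by rewrite ltr_wpDl// seminorm_ge0.
have A0 : 0 < `|a t| + 1 by rewrite ltr_wpDl.
have A'0 : 0 < `|a'| + 1 by rewrite ltr_wpDl.
have e3 : 0 < e / 3 by rewrite divr_gt0.
have ha1 := (has_deriv_realP a t a').1 ha _ (divr_gt0 e3 G0).
have hg1 := hg u hu _ (divr_gt0 e3 A0).
have ha2 : \forall s \near (0 : R), `|a (t + s) - a t| <= (`|a'| + 1) * `|s|.
  by apply: (has_deriv_le norm_seminorm _ ha); rewrite ltrDl.
have hg2 : \forall s \near (0 : R), u (g (t + s) - g t) < e / 3 / (`|a'| + 1).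
  by apply: (has_deriv_small hu _ hg); rewrite divr_gt0.
near=> s.
have -> : a (t + s) *: g (t + s) - a t *: g t
    - s *: (a' *: g t + a t *: l) =
  (a (t + s) - a t - s * a') *: g t + ((a (t + s) - a t) *: (g (t + s) - g t) +
  a t *: (g (t + s) - g t - s *: l)).
  rewrite [a t *: (_ - s *: l)]scalerBr [_ *: _ + (_ - _)]addrA -scalerDl subrK scalerBr.
  rewrite [in RHS]scalerBl [in RHS]scalerBl scalerDr !scalerA [a t * s]mulrC.
  set A := a (t + s) *: g t; rewrite opprD addrA.
  by rewrite -[in LHS](subrK A (_ *: g (t + s))) [RHS]addrC [RHS]addrAC !addrA.
have -> : e * `|s| = e / 3 * `|s| + (e / 3 * `|s| + e / 3 * `|s|) by field.
apply: le_trans (seminorm_add _ _ hu) _; rewrite (seminormZ _ _ hu) lerD//.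
  apply: le_trans (_ : _ <= `|a (t + s) - a t - s * a'| * (u (g t) + 1)) _.
    by rewrite ler_wpM2l// lerDl.
  by rewrite -ler_pdivlMr// mulrAC; near: s.
apply: le_trans (seminorm_add _ _ hu) _; rewrite !(seminormZ _ _ hu) lerD//.
  have -> : e / 3 * `|s| = (`|a'| + 1) * `|s| * (e / 3 / (`|a'| + 1)).
    by field; rewrite gt_eqF.
  apply: ler_pM => //; first exact: seminorm_ge0.
    by near: s.
  by apply: ltW; near: s.
apply: le_trans (_ : _ <= (`|a t| + 1) * u (g (t + s) - g t - s *: l)) _.
  by rewrite ler_wpM2r// ?seminorm_ge0// lerDl.
by rewrite mulrC -ler_pdivlMr// mulrAC; near: s.
Unshelve. all: by end_near. Qed.

Lemma has_deriv_comp (f : R -> E) (a : R -> R) (t a' : R) (l : E) :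
  has_deriv (E := R^o) a t a' -> has_deriv f (a t) l -> has_deriv (fun s => f (a s)) t (a' *: l).
Proof.
move=> ha hf u hu e e0.
have L0 : 0 < u l + 1 by rewrite ltr_wpDl// seminorm_ge0.
have A0 : 0 < `|a'| + 1 by rewrite ltr_wpDl.
have e2 : 0 < e / 2 by rewrite divr_gt0.
have ha1 := (has_deriv_realP a t a').1 ha _ (divr_gt0 e2 L0).
have ha2 : \forall s \near (0 : R), `|a (t + s) - a t| <= (`|a'| + 1) * `|s|.
  by apply: (has_deriv_le norm_seminorm _ ha); rewrite ltrDl.
have [d /= d0 hd] : exists2 d : R, 0 < d & forall s : R, `|s| < d ->
    u (f (a t + s) - f (a t) - s *: l) <= e / 2 / (`|a'| + 1) * `|s|.
  have /nbhs_ballP[d /= d0 hd] := hf u hu _ (divr_gt0 e2 A0).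
  by exists d => // s sd; apply: hd; rewrite /ball/= sub0r normrN.
have ha3 : \forall s \near (0 : R), `|a (t + s) - a t| < d.
  exact: (has_deriv_small norm_seminorm d0 ha).
near=> s.
have h1 : `|a (t + s) - a t| <= (`|a'| + 1) * `|s| by near: s.
have h2 : `|a (t + s) - a t| < d by near: s.
have h3 : `|a (t + s) - a t - s * a'| <= e / 2 / (u l + 1) * `|s| by near: s.
have [h hE] : exists h, a (t + s) = a t + h.
  by exists (a (t + s) - a t); rewrite [RHS]addrC subrK.
move: h1 h2 h3; have -> : a (t + s) - a t = h by rewrite hE addrAC subrr add0r.
move=> h1 h2 h3.
have -> : f (a (t + s)) - f (a t) - s *: (a' *: l) =
  (f (a t + h) - f (a t) - h *: l) + (h - s * a') *: l.
  by rewrite hE scalerBl scalerA addrA subrK.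
have -> : e * `|s| = e / 2 * `|s| + e / 2 * `|s| by field.
apply: le_trans (seminorm_add _ _ hu) _; rewrite (seminormZ _ _ hu) lerD//.
  have -> : e / 2 * `|s| = e / 2 / (`|a'| + 1) * ((`|a'| + 1) * `|s|).
    by field; rewrite gt_eqF.
  apply: le_trans (hd h _) _ => //.
  by rewrite ler_wpM2l// divr_ge0// ltW.
apply: le_trans (_ : _ <= `|h - s * a'| * (u l + 1)) _.
  by rewrite ler_wpM2l// lerDl.
by rewrite -ler_pdivlMr// mulrAC.
Unshelve. all: by end_near. Qed.

End Calculus1.
(** * Differentiable maps between locally convex spaces *)

Section Continuity.
Context {R : realType} {E : tvsType R}.

Lemma continuous_seminormP (T : topologicalType) (f : T -> E) (x : T) :
  {for x, continuous f} <-> forall u, continuous_seminorm u ->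
    forall e : R, 0 < e -> \forall y \near x, u (f y - f x) < e.
Proof.
split=> [fx u hu e e0|h B]; first exact: (fx _ (seminorm_nbhs (f x) hu e0)).
move=> /nbhs_seminorm [u hu uB].
by have := h u hu 1 ltr01; apply: filterS => y /uB.
Qed.

Lemma continuous_near_eq (T U : topologicalType) (f g : T -> U) (x : T) :
  (\forall y \near x, f y = g y) -> {for x, continuous f} -> {for x, continuous g}.
Proof.
move=> fg fx B; rewrite -(nbhs_singleton fg) => /fx fB.
by apply: filterS2 fg fB => y /= <-.
Qed.

Lemma open_setX (T U : topologicalType) (A : set T) (B : set U) :
  open A -> open B -> open (A `*` B).
Proof.
move=> oA oB; rewrite openE => -[x y] /= [Ax By].
by exists (A, B) => //=; split; apply: open_nbhs_nbhs.
Qed.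

Lemma continuous_pair (T U V : topologicalType) (f : T -> U) (g : T -> V) (x : T) :
  {for x, continuous f} -> {for x, continuous g} ->
  {for x, continuous (fun y => (f y, g y))}.
Proof.
move=> cf cg B [[P Q] /= [hP hQ] PQ].
have nf : \forall y \near x, P (f y) := cf P hP.
have ng : \forall y \near x, Q (g y) := cg Q hQ.
have : \forall y \near x, B (f y, g y).
  by apply: filterS2 nf ng => y hy1 hy2; apply: PQ.
by [].
Qed.

Lemma near_shift (t : R) (P : R -> Prop) :
  (\forall s \near t, P s) <-> (\forall s \near (0 : R), P (t + s)).
Proof.
split=> /nbhs_ballP [d /= d0 hd]; apply/nbhs_ballP; exists d => //= s;
  rewrite /ball/= => sd.
  by apply: hd; rewrite /ball/= opprD addrA subrr.
by rewrite -(subrK t s) addrC; apply: hd; rewrite /ball/= sub0r opprB.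
Qed.

Lemma has_deriv_continuous (f : R -> E) t l : has_deriv f t l -> {for t, continuous f}.
Proof.
move=> fl; apply/continuous_seminormP => u hu e e0; apply/near_shift.
exact: (has_deriv_small hu e0 fl).
Qed.

End Continuity.

Section DirectionalDerivatives.
Context {R : realType} {F E : tvsType R}.
Hypothesis hE : hausdorff_space E.
Implicit Types (f : F -> E) (x v : F) (U : set F).

Lemma diff_quotP f x v l : (diff_quot f x v s @[s --> 0^'] --> l) <->
  has_deriv (fun s => f (x + s *: v)) 0 l.
Proof.
rewrite has_deriv_cvgP; suff -> : diff_quot f x v =
    (fun s => s^-1 *: (f (x + (0 + s) *: v) - f (x + 0 *: v))) by [].
by apply/funext => s; rewrite /diff_quot add0r scale0r addr0.
Qed.

Lemma has_deriv_along f x v t l : has_deriv (fun s => f (x + t *: v + s *: v)) 0 l ->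
  has_deriv (fun s => f (x + s *: v)) t l.
Proof.
move=> h; apply/has_deriv_shift; apply: has_deriv_near h; near=> s.
by rewrite add0r scalerDl addrA.
Unshelve. all: by end_near. Qed.

Lemma dderivE f x v l : has_deriv (fun s => f (x + s *: v)) 0 l -> dderiv v f x = l.
Proof.
move=> /diff_quotP fl; apply: xget_unique => // l' fl'.
exact: (cvg_unique hE fl' fl).
Qed.

Lemma ddiff_has_deriv f x v : ddiff f x v ->
  has_deriv (fun s => f (x + s *: v)) 0 (dderiv v f x).
Proof. by move=> [l /diff_quotP fl]; rewrite (dderivE fl). Qed.

Lemma has_deriv_ident (t : R) : has_deriv (E := R^o) id t 1.
Proof.
apply/has_deriv_realP => e e0; near=> s.
have -> : t + s - t - s * 1 = 0 by ring.
by rewrite normr0 mulr_ge0// ltW.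
Unshelve. all: by end_near. Qed.

Lemma has_deriv_mulr (a t : R) : has_deriv (E := R^o) (fun s => s * a) t a.
Proof.
apply/has_deriv_realP => e e0; near=> s.
have -> : (t + s) * a - t * a - s * a = 0 by ring.
by rewrite normr0 mulr_ge0// ltW.
Unshelve. all: by end_near. Qed.

Lemma has_deriv_directionZ f x v (a : R) l : has_deriv (fun s => f (x + s *: v)) 0 l ->
  has_deriv (fun s => f (x + s *: (a *: v))) 0 (a *: l).
Proof.
move=> fl; have := @has_deriv_comp _ _ (fun s => f (x + s *: v)) (fun s => s * a) 0 a l.
rewrite mul0r => /(_ (has_deriv_mulr a 0) fl); apply: has_deriv_near; near=> s.
by rewrite scalerA.
Unshelve. all: by end_near. Qed.

Lemma dderivZ f x v (a : R) : ddiff f x v -> dderiv (a *: v) f x = a *: dderiv v f x.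
Proof. by move=> /ddiff_has_deriv fl; apply: dderivE; exact: has_deriv_directionZ. Qed.

Lemma dderiv_zero f x : dderiv 0 f x = 0.
Proof.
apply: dderivE; apply: has_deriv_near (has_deriv_cst 0 (f x)); near=> s.
by rewrite scaler0 addr0.
Unshelve. all: by end_near. Qed.

Lemma C1_ddiff k U f x v : leq_order 1 k -> Ck_on k U f -> U x -> ddiff f x v.
Proof. by move=> k1 [fd _] Ux; apply: (fd [::]). Qed.

(** The directional derivatives are jointly continuous in the point and the
  directions; here along any continuous choice of these. *)
Lemma Ck_continuous_along (T : topologicalType) k U f p (a : T -> F)
    (w : 'I_p -> T -> F) (z : T) : open U -> leq_order p k -> Ck_on k U f ->
  U (a z) -> {for z, continuous a} -> (forall i, {for z, continuous (w i)}) ->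
  {for z, continuous (fun y => iter_dderiv f [seq w i y | i <- enum 'I_p] (a y))}.
Proof.
move=> oU pk [_ /(_ _ pk)]; rewrite continuous_open_subspace; last first.
  by apply: open_setX => //; exact: openT.
move=> fc Ua ca cw.
pose h (y : T) : F * 'rV[F]_p := (a y, \row_i w i y).
pose D (z : F * 'rV[F]_p) := iter_dderiv f [seq z.2 ord0 i | i <- enum 'I_p] z.1.
have -> : (fun y => iter_dderiv f [seq w i y | i <- enum 'I_p] (a y)) = D \o h.
  apply/funext => y; rewrite /D /h /=; congr (iter_dderiv f _ _).
  by apply: eq_map => i; rewrite mxE.
have crow : {for z, continuous (fun y => \row_i w i y : 'rV[F]_p)}.
  move=> B [P hP PB].
  have : \forall y \near z, forall i, P ord0 i (w i y).
    apply: filter_forall => i; apply: cw.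
    by have := hP ord0 i; rewrite mxE.
  apply: filterS => y hy; apply: PB => i j; rewrite ord1 mxE; exact: hy.
have ch : {for z, continuous h} by exact: (continuous_pair ca crow).
by apply: continuous_comp ch _; apply: fc; rewrite inE; split.
Qed.

Lemma C1_continuous k U f x v : open U -> leq_order 1 k -> Ck_on k U f -> U x ->
  {for (x, v), continuous (fun z : F * F => dderiv z.2 f z.1)}.
Proof.
move=> oU k1 fk Ux.
have := @Ck_continuous_along (F * F)%type k U f 1 fst (fun _ => snd) (x, v) oU k1 fk Ux.
rewrite (_ : (fun y : F * F => iter_dderiv f _ _) = (fun z : F * F => dderiv z.2 f z.1)).
  by apply; [exact: cvg_fst|move=> _; exact: cvg_snd].
apply/funext => y; rewrite /iter_dderiv.
by rewrite enum_ordSl /= enum_ord0.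
Qed.

(** Mean value theorem: near a point, differences are controlled by a seminorm,
  because the derivative is continuous there, vanishes in the zero direction,
  and is homogeneous in the direction. *)
Lemma C1_lipschitz k U f x0 u : open U -> leq_order 1 k -> Ck_on k U f -> U x0 ->
  continuous_seminorm u ->
  exists2 q : F -> R, continuous_seminorm q & forall x y,
    q (x - x0) < 1 -> q (y - x0) < 1 -> [/\ U x, U y & u (f x - f y) <= q (x - y)].
Proof.
move=> oU k1 fk Ux0 hu.
have := C1_continuous (v := 0) oU k1 fk Ux0.
move=> /continuous_seminormP /(_ u hu 1 ltr01) [[A B] /= [nA nB] AB].
have nU : nbhs x0 U by apply: open_nbhs_nbhs.
have [q1 hq1 q1A] := nbhs_seminorm (filterI nA nU).
have [q2 hq2 q2B] := nbhs0_seminorm nB.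
have bound x w : q1 (x - x0) < 1 -> u (dderiv w f x) <= q2 w.
  move=> /q1A [Ax Ux]; apply/ler_addgt0Pr => e e0.
  have c0 : 0 < q2 w + e by rewrite ltr_wpDl// seminorm_ge0.
  have /q2B Bw : q2 ((q2 w + e)^-1 *: w) < 1.
    rewrite (seminormZ _ _ hq2) gtr0_norm ?invr_gt0// mulrC ltr_pdivrMr// mul1r.
    by rewrite ltrDl.
  have /= := AB (x, _) (conj Ax Bw); rewrite dderiv_zero subr0 dderivZ; last first.
    exact: (C1_ddiff _ k1 fk).
  by rewrite (seminormZ _ _ hu) gtr0_norm ?invr_gt0// mulrC ltr_pdivrMr// mul1r => /ltW.
exists (fun x => q1 x + q2 x); first exact: seminormD.
move=> x y hx hy.
have q1x : q1 (x - x0) < 1 by apply: le_lt_trans hx; rewrite lerDl seminorm_ge0.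
have q1y : q1 (y - x0) < 1 by apply: le_lt_trans hy; rewrite lerDl seminorm_ge0.
split; [by case: (q1A _ q1x)|by case: (q1A _ q1y)|].
apply: le_trans (_ : _ <= q2 (x - y)) _; last by rewrite lerDr seminorm_ge0.
have seg t : 0 <= t <= 1 -> q1 (y + t *: (x - y) - x0) < 1.
  move=> /andP[t0 t1].
  have -> : y + t *: (x - y) - x0 = (1 - t) *: (y - x0) + t *: (x - x0).
    rewrite scalerBl scale1r -[RHS]addrA [- _ + _]addrC -scalerBr opprB.
    by rewrite [x - x0 + _]addrA subrK addrAC.
  apply: le_lt_trans (seminorm_add _ _ hq1) _; rewrite !(seminormZ _ _ hq1).
  have [->|tn0] := eqVneq t 0; first by rewrite subr0 normr1 mul1r normr0 mul0r addr0.
  rewrite ger0_norm ?subr_ge0// (ger0_norm t0).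
  have tp : 0 < t by rewrite lt_neqAle eq_sym tn0.
  have : t * q1 (x - x0) < t by rewrite gtr_pMr.
  have : (1 - t) * q1 (y - x0) <= 1 - t.
    by rewrite -[leRHS]mulr1 ler_wpM2l ?subr_ge0// ltW.
  lra.
have := @mean_value _ _ (fun s => f (y + s *: (x - y)))
   (fun s => dderiv (x - y) f (y + s *: (x - y))) u 0 1 (q2 (x - y)) hu ler01.
rewrite scale1r scale0r addr0 subr0 mulr1 [y + _]addrC subrK; apply.
  move=> t t01; apply: has_deriv_along; apply: ddiff_has_deriv.
  by apply: (C1_ddiff _ k1 fk); case: (q1A _ (seg _ t01)).
by move=> t /seg; exact: bound.
Qed.

(** Chain rule: by the Lipschitz estimate, [f] along the curve and [f] along its
  tangent line differ by a quantity that is small to first order. *)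
Lemma has_deriv_C1_comp k U f (c : R -> F) t w : open U -> leq_order 1 k -> Ck_on k U f ->
  U (c t) -> has_deriv c t w -> has_deriv (fun s => f (c s)) t (dderiv w f (c t)).
Proof.
move=> oU k1 fk Uct cw u hu e e0.
have [q hq hL] := C1_lipschitz oU k1 fk Uct hu.
have e2 : 0 < e / 2 by rewrite divr_gt0.
have fw := ddiff_has_deriv (C1_ddiff w k1 fk Uct).
have lw := has_deriv_line 0 (c t) w.
have n1 := cw q hq _ e2; have n2 := fw u hu _ e2.
have n3 := has_deriv_small hq ltr01 cw; have n4 := has_deriv_small hq ltr01 lw.
apply: filterS2 (filterI n1 n2) (filterI n3 n4) => s [h1 h2] [h3 h4].
rewrite add0r scale0r addr0 in h2 h4.
have [_ _ h5] := hL _ _ h3 h4.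
have -> : e * `|s| = e / 2 * `|s| + e / 2 * `|s| by field.
have -> : f (c (t + s)) - f (c t) - s *: dderiv w f (c t) =
  (f (c (t + s)) - f (c t + s *: w)) +
  (f (c t + s *: w) - f (c t) - s *: dderiv w f (c t)).
  by rewrite !addrA subrK.
apply: le_trans (seminorm_add _ _ hu) _; apply: lerD => //.
by apply: le_trans h5 _; rewrite opprD addrA.
Qed.

End DirectionalDerivatives.
Section AffinePrecomposition.
Context {R : realType} {F F' E : tvsType R}.
Variables (L : F' -> F) (a : F).
Hypothesis L_add : forall x y, L (x + y) = L x + L y.
Hypothesis L_scale : forall (c : R) x, L (c *: x) = c *: L x.
Hypothesis L_cont : continuous L.

Lemma diff_quot_affine (f : F -> E) x v :
  diff_quot (fun x => f (a + L x)) x v = diff_quot f (a + L x) (L v).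
Proof. by apply/funext => s; rewrite /diff_quot L_add L_scale addrA. Qed.

Lemma iter_dderiv_affine (f : F -> E) vs :
  iter_dderiv (fun x => f (a + L x)) vs =
  (fun x => iter_dderiv f [seq L v | v <- vs] (a + L x)).
Proof.
elim: vs f => //= v vs IH f; rewrite -IH; congr iter_dderiv.
by apply/funext => x; rewrite /dderiv diff_quot_affine.
Qed.

Lemma coord_row_continuous (T : topologicalType) p (z : T * 'rV[F']_p) (i : 'I_p) :
  {for z, continuous (fun z : T * 'rV[F']_p => z.2 ord0 i)}.
Proof.
move=> B Bz; exists (setT, [set M : 'rV[F']_p | B (M ord0 i)]) => /=; last by move=> ? [].
split; first exact: filterT.
exists (fun _ j => if j == i then B else setT) => /=.
  by move=> k j; rewrite ord1; case: eqP => [->|_] //; exact: filterT.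
by move=> M hM; have := hM ord0 i; rewrite eqxx.
Qed.

Lemma affine_continuous : continuous (fun x => a + L x).
Proof.
move=> x; have ca : {for x, continuous (fun _ : F' => a)} by exact: cst_continuous.
have h := continuous_pair ca (L_cont (x := x)).
exact: (continuous_comp h (@add_continuous F (a, L x))).
Qed.

Lemma open_affine (U : set F) : open U -> open [set x | U (a + L x)].
Proof. by move=> oU; apply: open_comp => // x _; exact: affine_continuous. Qed.

Lemma Ck_on_affine k (U : set F) (f : F -> E) : open U -> Ck_on k U f ->
  Ck_on k [set x | U (a + L x)] (fun x => f (a + L x)).
Proof.
move=> oU fk; split=> [vs v x hk Ux|p pk].
  have [fd _] := fk; have [|l hl] := fd [seq L w | w <- vs] (L v) (a + L x) _ Ux.
    by rewrite size_map.
  by exists l; rewrite iter_dderiv_affine diff_quot_affine.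
rewrite continuous_open_subspace; last first.
  by apply: open_setX; [exact: open_affine|exact: openT].
move=> z; rewrite inE => -[Uz _].
rewrite (_ : (fun z => _) = (fun y : F' * 'rV[F']_p =>
    iter_dderiv f [seq L (y.2 ord0 i) | i <- enum 'I_p] (a + L y.1))); last first.
  by apply/funext => y; rewrite iter_dderiv_affine -map_comp.
have ca : {for z, continuous (fun y : F' * 'rV[F']_p => a + L y.1)}.
  apply: (@continuous_comp _ _ _ fst (fun x => a + L x)); last exact: affine_continuous.
  by case: (z) => z1 z2; exact: cvg_fst.
have cw i : {for z, continuous (fun y : F' * 'rV[F']_p => L (y.2 ord0 i))}.
  apply: (@continuous_comp _ _ _ (fun y : F' * 'rV[F']_p => y.2 ord0 i) L).
    exact: coord_row_continuous.
  exact: L_cont.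
have h := Ck_continuous_along (w := fun i (y : F' * 'rV[F']_p) => L (y.2 ord0 i)) oU pk fk Uz ca cw.
exact h.
Qed.

End AffinePrecomposition.

Lemma Ck_on_slice {R : realType} {F F' E : tvsType R} k
    (U : set (F * F')) (f : F * F' -> E) (y : F') : open U -> Ck_on k U f ->
  Ck_on k [set x | U (x, y)] (fun x => f (x, y)).
Proof.
move=> oU fk.
have aE (x : F) : (0, y) + (x, 0) = (x, y) :> F * F'.
  by congr (_, _); rewrite ?add0r ?addr0.
have cL : continuous (fun x : F => (x, 0) : F * F').
  by move=> x; apply: continuous_pair => B //; exact: cst_continuous.
have := @Ck_on_affine R (F * F')%type F E (fun x => (x, 0)) (0, y).
move=> /(_ _ _ cL k U f oU fk); rewrite (_ : (fun x => f _) = fun x => f (x, y)).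
  rewrite (_ : [set x | U ((0, y) + (x, 0))] = [set x | U (x, y)]); last by apply/funext => x /=; rewrite aE.
  apply=> [x x'|c x]; first by congr (_, _); rewrite addr0.
  by congr (_, _); rewrite scaler0.
by apply/funext => x; rewrite aE.
Qed.

(** * Smooth curves *)

Section SmoothCurves.
Context {R : realType}.

Lemma continuous_scale (E : tvsType R) (T : topologicalType) (a : T -> R)
    (g : T -> E) (t : T) : {for t, continuous a} -> {for t, continuous g} ->
  {for t, continuous (fun s => a s *: g s)}.
Proof.
move=> ca cg; have h := @continuous_pair T (R^o) E a g t ca cg.
exact: (continuous_comp h (@scale_continuous R E (a t, g t))).
Qed.

Lemma continuous_add (E : tvsType R) (T : topologicalType) (f g : T -> E) (t : T) :
  {for t, continuous f} -> {for t, continuous g} ->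
  {for t, continuous (fun s => f s + g s)}.
Proof.
move=> cf cg; have h := continuous_pair cf cg.
exact: (continuous_comp h (@add_continuous E (f t, g t))).
Qed.

Section Smooth.
Context {E : tvsType R}.

(** Class [C^n] by successive derivatives: a derivative is produced at each stage
  rather than computed by an operator, as suits inductive closure proofs. *)
Fixpoint smooth (n : nat) (U : set R) (f : R -> E) : Prop :=
  if n is n'.+1 then
    exists2 f', (forall t, U t -> has_deriv f t (f' t)) & smooth n' U f'
  else forall t, U t -> {for t, continuous f}.

Implicit Types (U V : set R) (f g : R -> E) (a : R -> R) (n : nat).

Lemma smooth_congr n U f g : open U -> (forall t, U t -> f t = g t) ->
  smooth n U f -> smooth n U g.
Proof.
move=> oU fg.
have nfg t : U t -> \forall s \near t, f s = g s.
  by move=> Ut; apply: filterS (open_nbhs_nbhs (conj oU Ut)) => s; exact: fg.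
case: n => [fc t Ut|n [f' ff' f's]].
  by apply: continuous_near_eq (nfg t Ut) _; exact: fc.
exists f' => // t Ut; apply: has_deriv_near (ff' t Ut).
exact: ((near_shift t (fun s => f s = g s)).1 (nfg t Ut)).
Qed.

Lemma smooth_continuous n U f t : smooth n U f -> U t -> {for t, continuous f}.
Proof.
by case: n => [|n] /=; [apply|move=> [f' ff' _] /ff'; exact: has_deriv_continuous].
Qed.

Lemma smoothW n U f : smooth n.+1 U f -> smooth n U f.
Proof.
elim: n f => [|n IH] f; last by move=> [f' ff' /IH f's]; exists f'.
by move=> fs t; exact: (smooth_continuous fs).
Qed.

Lemma smooth_sub n U V f : V `<=` U -> smooth n U f -> smooth n V f.
Proof.
move=> VU; elim: n f => [|n IH] f /=; first by move=> fc t /VU; exact: fc.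
by move=> [f' ff' /IH f's]; exists f' => // t /VU; exact: ff'.
Qed.

Lemma smooth_cst n U (c : E) : smooth n U (fun _ => c).
Proof.
elim: n c => [|n IH] c /=; first by move=> t _; exact: cst_continuous.
by exists (fun _ => 0) => // t _; exact: has_deriv_cst.
Qed.

Lemma smoothD n U f g : smooth n U f -> smooth n U g ->
  smooth n U (fun t => f t + g t).
Proof.
elim: n f g => [|n IH] f g /=.
  by move=> fc gc t Ut; apply: continuous_add; [exact: fc|exact: gc].
move=> [f' ff' fs] [g' gg' gs]; exists (fun t => f' t + g' t); last exact: IH.
by move=> t Ut; apply: has_derivD; [exact: ff'|exact: gg'].
Qed.

End Smooth.

Section Smooth2.
Context {E : tvsType R}.
Implicit Types (U V : set R) (f g : R -> E) (a : R -> R) (n : nat).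

Lemma smooth_scale n U a g : smooth (E := R^o) n U a -> smooth n U g ->
  smooth n U (fun t => a t *: g t).
Proof.
elim: n a g => [|n IH] a g.
  by move=> /= ac gc t Ut; apply: continuous_scale; [exact: ac|exact: gc].
move=> sa sg; have [a' aa' as'] := sa; have [g' gg' gs'] := sg.
exists (fun t => a' t *: g t + a t *: g' t).
  by move=> t Ut; apply: has_deriv_scale; [exact: aa'|exact: gg'].
by apply: smoothD; apply: IH => //; exact: smoothW.
Qed.

Lemma smooth_comp n U V a f : smooth (E := R^o) n U a ->
  (forall t, U t -> V (a t)) -> smooth n V f -> smooth n U (fun t => f (a t)).
Proof.
move=> + aV; elim: n f => [|n IH] f.
  move=> /= ac fc t Ut; apply: (@continuous_comp _ _ _ a f); first exact: ac.
  by apply: fc; exact: aV.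
move=> sa [f' ff' f's]; have [a' aa' as'] := sa.
exists (fun t => a' t *: f' (a t)).
  by move=> t Ut; apply: has_deriv_comp; [exact: aa'|apply: ff'; exact: aV].
by apply: smooth_scale => //; apply: IH => //; exact: smoothW.
Qed.

Lemma smooth_derivatives n U f : smooth n U f -> exists G : nat -> R -> E,
  [/\ G 0%N = f,
      forall p t, (p <= n)%N -> U t -> {for t, continuous (G p)} &
      forall p t, (p < n)%N -> U t -> has_deriv (G p) t (G p.+1 t)].
Proof.
elim: n f => [|n IH] f.
  by move=> fc; exists (fun _ => f); split => // p t _; exact: fc.
move=> sf; have [f' ff' /IH [G [G0 Gc Gd]]] := sf.
exists (fun p => if p is p'.+1 then G p' else f); split => //.
  by move=> [|p] t pn Ut; [exact: (smooth_continuous sf)|exact: Gc].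
by move=> [|p] t pn Ut; [rewrite G0; exact: ff'|exact: Gd].
Qed.

(** For maps on the line, the directional derivatives are the multiples of the
  successive derivatives by the product of the directions. *)
Lemma smooth_Ck_on n U f : hausdorff_space E -> open U -> smooth n U f ->
  Ck_on (F := R^o) (Some n) U f.
Proof.
move=> hE oU /smooth_derivatives [G [G0 Gc Gd]].
have near_in t : U t -> \forall s \near t, U s.
  by move=> Ut; exact: open_nbhs_nbhs.
have scaled_deriv (g : R -> E) (c : R) p t v : U t -> (p < n)%N ->
    (forall s, U s -> g s = c *: G p s) ->
    has_deriv (fun s => g (t + s *: (v : R^o))) 0 ((c * v) *: G p.+1 t).
  move=> Ut pn gG.
  have h1 : has_deriv g t (c *: G p.+1 t).
    have := has_deriv_scale (has_deriv_cst (E := R^o) t c) (Gd p t pn Ut).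
    rewrite scale0r add0r; apply: has_deriv_near.
    apply: ((near_shift t (fun s => c *: G p s = g s)).1 _).
    by apply: filterS (near_in t Ut) => s Us; rewrite gG.
  rewrite mulrC -scalerA.
  have /has_deriv_shift h2 := h1.
  have := @has_deriv_comp R E (fun s => g (t + s)) (fun s => s * v) 0 v _.
  rewrite mul0r => /(_ _ (has_deriv_mulr v 0) h2); exact: id.
have iterE vs t : (size vs <= n)%N -> U t ->
    iter_dderiv (F := R^o) f vs t = (\prod_(v <- vs) (v : R)) *: G (size vs) t.
  elim/last_ind: vs t => [|vs v IH] t; first by rewrite big_nil scale1r G0.
  rewrite size_rcons => hn Ut; rewrite -cats1 /iter_dderiv foldl_cat /=.
  rewrite big_cat big_seq1 /=.
  by apply: dderivE => //; apply: scaled_deriv => // s Us; exact: (IH s (ltnW hn) Us).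
split=> [vs v x hk Ux|p pk].
  eexists; apply/diff_quotP; apply: (scaled_deriv _ _ (size vs)) => // s Us.
  by apply: iterE => //; exact: ltnW.
rewrite continuous_open_subspace; last by apply: open_setX => //; exact: openT.
move=> z; rewrite inE => -[Uz _].
have nz : \forall y \near z, U y.1.
  by exists (U, setT) => /=; [split; [exact: near_in|exact: filterT]|move=> y []].
apply: (@continuous_near_eq _ _ (fun y : R^o * 'rV[R^o]_p =>
  (\prod_(i <- enum 'I_p) (y.2 ord0 i : R)) *: G p y.1)).
  apply: filterS nz => y Uy.
  have sz : size [seq y.2 ord0 i | i <- enum 'I_p] = p by rewrite size_map size_enum_ord.
  by have := iterE [seq y.2 ord0 i | i <- enum 'I_p] y.1; rewrite sz big_map => ->.
apply: continuous_scale.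
  elim: (enum 'I_p) => [|i s IH].
    rewrite (_ : (fun _ => _) = fun _ => 1); first exact: cst_continuous.
    by apply/funext => y; rewrite big_nil.
  rewrite (_ : (fun _ => _) = fun y : R^o * 'rV[R^o]_p =>
     (y.2 ord0 i : R) *: (\prod_(i <- s) (y.2 ord0 i : R) : R^o)); last first.
    by apply/funext => y; rewrite big_cons.
  by apply: continuous_scale => //; exact: coord_row_continuous.
apply: (@continuous_comp _ _ _ fst (G p)); last exact: Gc.
by case: (z) => z1 z2; exact: cvg_fst.
Qed.

End Smooth2.

(** Differentiating along the line appends its direction [w] to the directions
  [vs] already used. *)
Lemma smooth_line (F E : tvsType R) (hE : hausdorff_space E) n (U : set F)
    (f : F -> E) (vs : seq F) (x w : F) : open U -> Ck_on None U f ->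
  smooth n [set r | U (x + r *: w)] (fun r => iter_dderiv f vs (x + r *: w)).
Proof.
move=> oU fk; elim: n vs => [|n IH] vs /=.
  move=> r Ur.
  have -> : vs = [seq nth 0 vs (i : 'I_(size vs)) | i : 'I_(size vs) <- enum 'I_(size vs)].
    by rewrite (map_comp (nth 0 vs) val) val_enum_ord; exact/esym/mkseq_nth.
  have ca : {for r, continuous (fun r : R => x + r *: w)}.
    apply: continuous_add; first exact: cst_continuous.
    by apply: continuous_scale; [move=> B|exact: cst_continuous].
  have cw (i : 'I_(size vs)) : {for r, continuous (fun _ : R => nth 0 vs i)}.
    exact: cst_continuous.
  have p0 : leq_order (size vs) None by [].
  have h := Ck_continuous_along (w := fun i (_ : R) => nth 0 vs i) oU p0 fk Ur ca cw.
  exact h.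
exists (fun r => iter_dderiv f (rcons vs w) (x + r *: w)) => // r Ur.
apply: has_deriv_along; rewrite -cats1 /iter_dderiv foldl_cat /=.
by apply: ddiff_has_deriv => //; apply: fk.1.
Qed.

End SmoothCurves.
(** * Charts of a Lie group *)

Lemma Ck_on_sub {R : realType} {F E : tvsType R} k (U V : set F) (f : F -> E) :
  open U -> open V -> V `<=` U -> Ck_on k U f -> Ck_on k V f.
Proof.
move=> oU oV VU [fd fc]; split=> [vs v x hk /VU|p pk]; first exact: fd.
have := fc p pk; rewrite !continuous_open_subspace.
- by move=> h z; rewrite inE => -[/VU Uz _]; apply: h; rewrite inE.
- by apply: open_setX => //; exact: openT.
- by apply: open_setX => //; exact: openT.
Qed.

Lemma seminorm_pullback {R : realType} {E F : tvsType R} (L : E -> F) (u : F -> R) :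
  (forall x y, L (x + y) = L x + L y) -> (forall (c : R) x, L (c *: x) = c *: L x) ->
  continuous L -> continuous_seminorm u -> continuous_seminorm (fun x => u (L x)).
Proof.
move=> LD LZ Lc hu; have [_ _ uc] := hu; split=> [x y|c x|x].
- by rewrite LD seminorm_add.
- by rewrite LZ seminormZ.
- by apply: continuous_comp; [exact: Lc|exact: uc].
Qed.

Section ProductSeminorms.
Context {R : realType} {E F : tvsType R}.

Lemma inl_continuous : continuous (fun x : E => (x, 0 : F)).
Proof. by move=> x; apply: continuous_pair => B //; exact: cst_continuous. Qed.

Lemma inr_continuous : continuous (fun y : F => (0 : E, y)).
Proof. by move=> x; apply: continuous_pair => B //; exact: cst_continuous. Qed.

Lemma seminorm_inl (u : E * F -> R) : continuous_seminorm u ->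
  continuous_seminorm (fun x => u (x, 0)).
Proof.
apply: seminorm_pullback; last exact: inl_continuous.
  by move=> x y; congr (_, _); rewrite addr0.
by move=> c x; congr (_, _); rewrite scaler0.
Qed.

Lemma seminorm_inr (u : E * F -> R) : continuous_seminorm u ->
  continuous_seminorm (fun y => u (0, y)).
Proof.
apply: seminorm_pullback; last exact: inr_continuous.
  by move=> x y; congr (_, _); rewrite addr0.
by move=> c x; congr (_, _); rewrite scaler0.
Qed.

Lemma seminorm_pair (u : E * F -> R) x y : continuous_seminorm u ->
  u (x, y) <= u (x, 0) + u (0, y).
Proof.
move=> hu; rewrite (_ : (x, y) = (x, 0) + (0, y)); first exact: seminorm_add.
by congr (_, _); rewrite ?addr0 ?add0r.
Qed.

Lemma has_deriv_inl (x : R -> E) (y : F) t l : has_deriv x t l ->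
  has_deriv (fun s => (x s, y)) t (l, 0).
Proof.
move=> xl u hu e e0; apply: filterS (xl _ (seminorm_inl hu) e e0) => s.
apply: le_trans; rewrite le_eqVlt; apply/orP; left; apply/eqP; congr u.
by apply: injective_projections => //=; rewrite subrr scaler0 subr0.
Qed.

End ProductSeminorms.

Section LieGroupCharts.
Context {R : realType} {E : tvsType R} {G : lieGroupType E}.
Hypothesis hE : hausdorff_space E.
Implicit Types (c d : chart G E) (x g : G) (y : E).

Lemma chart_is_chart c : atlas c -> is_chart c.
Proof. by have [h _ _ _] := @lie_smooth_structure R E G; apply: h. Qed.

Lemma chart_at x : exists2 c : chart G E, atlas c & chart_dom c x.
Proof. by have [_ h _ _] := @lie_smooth_structure R E G; apply: h. Qed.

Lemma open_chart_dom c : atlas c -> open (chart_dom c).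
Proof. by move=> /chart_is_chart [[]]. Qed.

Lemma open_chart_cod c : atlas c -> open (chart_cod c).
Proof. by move=> /chart_is_chart [[]]. Qed.

Lemma chartK c x : atlas c -> chart_dom c x -> chart_inv c (c x) = x.
Proof. by move=> /chart_is_chart [_ h _ _ _] /h []. Qed.

Lemma chart_codP c x : atlas c -> chart_dom c x -> chart_cod c (c x).
Proof. by move=> /chart_is_chart [_ h _ _ _] /h []. Qed.

Lemma chart_invK c y : atlas c -> chart_cod c y -> c (chart_inv c y) = y.
Proof. by move=> /chart_is_chart [_ _ h _ _] /h []. Qed.

Lemma chart_domP c y : atlas c -> chart_cod c y -> chart_dom c (chart_inv c y).
Proof. by move=> /chart_is_chart [_ _ h _ _] /h []. Qed.

Lemma chart_continuous c x : atlas c -> chart_dom c x -> {for x, continuous c}.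
Proof.
move=> hc cx; have [_ _ _ h _] := chart_is_chart hc; move: h.
by rewrite continuous_open_subspace; [apply; rewrite inE|exact: open_chart_dom].
Qed.

Lemma chart_inv_continuous c y : atlas c -> chart_cod c y ->
  {for y, continuous (chart_inv c)}.
Proof.
move=> hc cy; have [_ _ _ _ h] := chart_is_chart hc; move: h.
by rewrite continuous_open_subspace; [apply; rewrite inE|exact: open_chart_cod].
Qed.

Lemma chart_dom_near c x : atlas c -> chart_dom c x -> \forall y \near x, chart_dom c y.
Proof. by move=> hc cx; apply: open_nbhs_nbhs; split=> //; exact: open_chart_dom. Qed.

Lemma chart_cod_near c y : atlas c -> chart_cod c y -> \forall z \near y, chart_cod c z.
Proof. by move=> hc cx; apply: open_nbhs_nbhs; split=> //; exact: open_chart_cod. Qed.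

Lemma chart_nbhs c x (W : set G) : atlas c -> chart_dom c x -> nbhs x W ->
  exists2 p, continuous_seminorm p &
    forall z, p (z - c x) < 1 -> chart_cod c z /\ W (chart_inv c z).
Proof.
move=> hc cx xW; have cy := chart_codP hc cx.
have h : nbhs (c x) [set z | W (chart_inv c z)].
  by apply: (chart_inv_continuous hc cy); rewrite /= chartK.
have [p hp pW] := nbhs_seminorm (filterI (chart_cod_near hc cy) h).
by exists p => // z /pW [].
Qed.

Lemma chart_ball_near c x p (e : R) : atlas c -> chart_dom c x ->
  continuous_seminorm p -> 0 < e ->
  \forall y \near x, chart_dom c y /\ p (c y - c x) < e.
Proof.
move=> hc cx hp e0.
have h := (continuous_seminormP c x).1 (chart_continuous hc cx) p hp e e0.
by apply: filterS2 (chart_dom_near hc cx) h.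
Qed.

Lemma mulg_continuous : continuous (fun z : G * G => (z.1 * z.2)%g).
Proof.
have [h _] := @lie_mul_smooth R E G; move: h.
rewrite continuous_open_subspace; last exact: openT.
by move=> h z; apply: h; rewrite inE.
Qed.

Lemma invg_continuous : continuous (fun x : G => (x^-1)%g).
Proof.
have [h _] := @lie_inv_smooth R E G; move: h.
rewrite continuous_open_subspace; last exact: openT.
by move=> h z; apply: h; rewrite inE.
Qed.

Lemma continuous_mulg (T : topologicalType) (f g : T -> G) (t : T) :
  {for t, continuous f} -> {for t, continuous g} ->
  {for t, continuous (fun s => f s * g s)%g}.
Proof.
move=> cf cg; have h := continuous_pair cf cg.
exact: (continuous_comp h (@mulg_continuous (f t, g t))).
Qed.

Lemma continuous_invg (T : topologicalType) (f : T -> G) (t : T) :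
  {for t, continuous f} -> {for t, continuous (fun s => (f s)^-1)%g}.
Proof. by move=> cf; exact: (continuous_comp cf (@invg_continuous (f t))). Qed.

Definition chart_mul c1 c2 c3 (z : E * E) : E :=
  c3 (chart_inv c1 z.1 * chart_inv c2 z.2)%g.

Definition chart_mul_dom c1 c2 c3 : set (E * E) :=
  [set z | (chart_cod c1 z.1 /\ chart_cod c2 z.2) /\
           chart_dom c3 (chart_inv c1 z.1 * chart_inv c2 z.2)%g].

Lemma open_chart_mul_dom c1 c2 c3 : atlas c1 -> atlas c2 -> atlas c3 ->
  open (chart_mul_dom c1 c2 c3).
Proof.
move=> h1 h2 h3; rewrite openE => -[x y] /= [[cx cy] cxy].
have n0 : nbhs (x, y) (chart_cod c1 `*` chart_cod c2).
  apply: open_nbhs_nbhs; split => //.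
  by apply: open_setX; exact: open_chart_cod.
have i1 : {for (x, y), continuous (fun z : E * E => chart_inv c1 z.1)}.
  apply: (@continuous_comp _ _ _ fst (chart_inv c1)); first exact: cvg_fst.
  exact: chart_inv_continuous.
have i2 : {for (x, y), continuous (fun z : E * E => chart_inv c2 z.2)}.
  apply: (@continuous_comp _ _ _ snd (chart_inv c2)); first exact: cvg_snd.
  exact: chart_inv_continuous.
have := continuous_mulg i1 i2 (chart_dom_near h3 cxy).
by rewrite /interior; apply: filterS2 n0 => z [].
Qed.

Lemma chart_mul_Ck c1 c2 c3 : atlas c1 -> atlas c2 -> atlas c3 ->
  Ck_on None (chart_mul_dom c1 c2 c3) (chart_mul c1 c2 c3).
Proof.
move=> h1 h2 h3; have [_ h] := @lie_mul_smooth R E G.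
have := h (prod_chart c1 c2) c3 _ h3; rewrite /comp /=.
rewrite (_ : _ `&` _ = chart_mul_dom c1 c2 c3).
  by apply; exists c1 => //; exists c2.
apply/seteqP; split => -[x y] /=; first by move=> [[]] ? ? [].
by move=> [[]].
Qed.

(** The inversion being smooth, this chart is compatible with the atlas, hence in
  it by maximality. Reading a second factor in such a chart turns the division
  [x * y^-1] into an instance of [chart_mul], whose smoothness is given. *)
Definition inv_chart c : chart G E :=
  Chart [set x | chart_dom c x^-1%g] (chart_cod c)
        (fun x => c x^-1%g) (fun y => (chart_inv c y)^-1)%g.

Lemma inv_chart_atlas c : atlas c -> atlas (inv_chart c).
Proof.
move=> hc; have [_ _ _ maxA] := @lie_smooth_structure R E G.
have odom : open (chart_dom (inv_chart c)).
  apply: (@open_comp _ _ (fun x : G => x^-1%g)); last exact: open_chart_dom.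
  by move=> x _; exact: invg_continuous.
apply: maxA.
  split=> /=.
  - by split; [|exact: open_chart_cod].
  - by move=> x cx; rewrite chartK// invgK; split=> //; exact: chart_codP.
  - by move=> y cy; rewrite invgK chart_invK//; split=> //; exact: chart_domP.
  - rewrite continuous_open_subspace// => x; rewrite inE /= => cx.
    apply: (@continuous_comp _ _ _ (fun x : G => x^-1%g) c); first exact: invg_continuous.
    exact: chart_continuous.
  - rewrite continuous_open_subspace; last exact: open_chart_cod.
    move=> y; rewrite inE => cy; apply: continuous_invg.
    exact: chart_inv_continuous.
have [_ sm] := @lie_inv_smooth R E G.
move=> d hd; split=> /=.
  have := sm c d hc hd; rewrite (_ : _ `&` _ = chart_cod c `&` chart_inv (inv_chart c) @^-1` chart_dom d)//.
  by apply/seteqP; split => x /=; [move=> [? []]|move=> []].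
have := sm d c hd hc; rewrite (_ : _ `&` _ = chart_cod d `&` chart_inv d @^-1` chart_dom (inv_chart c))//.
by apply/seteqP; split => x /=; [move=> [? []]|move=> []].
Qed.

(** Right translates of charts belong to the atlas as well, the transition maps
  being slices of the multiplication. The velocity of a curve at [g^-1] is thus
  read directly at the unit. *)
Definition translated_chart c g : chart G E :=
  Chart [set x | chart_dom c (x * g)%g] (chart_cod c)
        (fun x => c (x * g)%g) (fun y => chart_inv c y * g^-1)%g.

Lemma right_translation_continuous g : continuous (fun x : G => x * g)%g.
Proof. by move=> x; apply: continuous_mulg => [B //|]; exact: cst_continuous. Qed.

Lemma right_translate_Ck c d g : atlas c -> atlas d ->
  Ck_on None (chart_cod c `&` [set y | chart_dom d (chart_inv c y * g)%g])
    (fun y => d (chart_inv c y * g)%g).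
Proof.
move=> hc hd; have [e he eg] := chart_at g.
have := Ck_on_slice (e g) (open_chart_mul_dom hc he hd) (chart_mul_Ck hc he hd).
rewrite /chart_mul /chart_mul_dom /= chartK//.
rewrite (_ : [set x | _] = chart_cod c `&` [set y | chart_dom d (chart_inv c y * g)%g])//.
apply/seteqP; split => y /=; first by move=> [[]].
by move=> [cy dy]; do 2 split => //; exact: chart_codP.
Qed.

Lemma translated_chart_atlas c g : atlas c -> atlas (translated_chart c g).
Proof.
move=> hc; have [_ _ _ maxA] := @lie_smooth_structure R E G.
have odom : open (chart_dom (translated_chart c g)).
  apply: (@open_comp _ _ (fun x : G => x * g)%g); last exact: open_chart_dom.
  by move=> x _; exact: right_translation_continuous.
apply: maxA.
  split=> /=.
  - by split; [|exact: open_chart_cod].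
  - by move=> x cx; rewrite chartK// mulgK; split=> //; exact: chart_codP.
  - by move=> y cy; rewrite mulgVK chart_invK//; split=> //; exact: chart_domP.
  - rewrite continuous_open_subspace// => x; rewrite inE /= => cx.
    apply: (@continuous_comp _ _ _ (fun x : G => x * g)%g c).
      exact: right_translation_continuous.
    exact: chart_continuous.
  - rewrite continuous_open_subspace; last exact: open_chart_cod.
    move=> y; rewrite inE => cy; apply: continuous_mulg; last exact: cst_continuous.
    exact: chart_inv_continuous.
by move=> d hd; split=> /=; exact: right_translate_Ck.
Qed.

(** The multiplication is of class C1 in charts, so the mean value theorem
  applies; one seminorm serves for both factors. *)
Lemma mulg_lipschitz c1 c2 c3 (x0 y0 : G) (u : E -> R) : atlas c1 -> atlas c2 -> atlas c3 ->
  chart_dom c1 x0 -> chart_dom c2 y0 -> chart_dom c3 (x0 * y0)%g ->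
  continuous_seminorm u ->
  exists2 q : E -> R, continuous_seminorm q &
    exists N1 N2, [/\ nbhs x0 N1, nbhs y0 N2,
      (forall x, N1 x -> chart_dom c1 x), (forall y : G, N2 y -> chart_dom c2 y) &
      forall (x x' y y' : G), N1 x -> N1 x' -> N2 y -> N2 y' ->
        chart_dom c3 (x * y)%g /\
        u (c3 (x * y)%g - c3 (x' * y')%g) <= q (c1 x - c1 x') + q (c2 y - c2 y')].
Proof.
move=> h1 h2 h3 d1 d2 d3 hu.
have z0 : chart_mul_dom c1 c2 c3 (c1 x0, c2 y0).
  by split=> /=; rewrite ?chartK//; split; exact: chart_codP.
have [q hq hL] := C1_lipschitz (k := None) hE (open_chart_mul_dom h1 h2 h3) isT
  (chart_mul_Ck h1 h2 h3) z0 hu.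
have ql := seminorm_inl hq; have qr := seminorm_inr hq.
exists (fun z : E => q (z, 0) + q (0, z)); first exact: seminormD.
have e2 : (0 : R) < 2^-1 by rewrite invr_gt0.
exists [set x | chart_dom c1 x /\ q (c1 x - c1 x0, 0) < 2^-1].
exists [set y | chart_dom c2 y /\ q (0, c2 y - c2 y0) < 2^-1].
split; [exact: (chart_ball_near h1 d1 ql e2)|exact: (chart_ball_near h2 d2 qr e2)
  |by move=> x []|by move=> y []|].
have near_z (x y : G) : q (c1 x - c1 x0, 0) < 2^-1 -> q (0, c2 y - c2 y0) < 2^-1 ->
    q ((c1 x, c2 y) - (c1 x0, c2 y0)) < 1.
  move=> hx hy; apply: le_lt_trans (seminorm_pair _ _ hq) _.
  by rewrite [ltRHS]splitr div1r ltrD.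
move=> x x' y y' /= [dx qx] [dx' qx'] [dy qy] [dy' qy'].
have [[_ hxy] _] := hL _ _ (near_z _ _ qx qy) (near_z _ _ qx' qy').
rewrite /chart_mul /= in hxy *; rewrite !chartK// in hxy * => ub; split=> //.
apply: le_trans ub _; apply: le_trans (seminorm_pair _ _ hq) _.
by apply: lerD; rewrite ?lerDl ?lerDr seminorm_ge0.
Qed.

End LieGroupCharts.
(** * Curves in a Lie group and their logarithmic derivatives *)

Lemma open_preimage_in (T U : topologicalType) (J : set T) (f : T -> U) (D : set U) :
  open J -> (forall t, J t -> {for t, continuous f}) -> open D ->
  open (J `&` f @^-1` D).
Proof.
move=> oJ fc oD; rewrite openE => t [Jt Dt].
have h : \forall s \near t, D (f s) by apply: (fc t Jt); exact: open_nbhs_nbhs.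
have h' : \forall s \near t, J s by exact: open_nbhs_nbhs.
by rewrite /interior; apply: filterS2 h h' => s.
Qed.

Lemma Ck_curveP {R : realType} (M : topologicalType) (E : tvsType R)
    (A : set (chart M E)) k (J : set R) (f : R -> M) : open J ->
  Ck_curve A k J f <-> (forall t, J t -> {for t, continuous f}) /\
    forall d, A d -> Ck_on (F := R^o) k (J `&` f @^-1` chart_dom d) (fun t => d (f t)).
Proof.
move=> oJ.
have setE (d : chart M E) : chart_cod (@id_chart R^o) `&`
    chart_inv (@id_chart R^o) @^-1` (J `&` f @^-1` chart_dom d) =
    J `&` f @^-1` chart_dom d.
  by apply/seteqP; split => x /=; [case|].
rewrite /Ck_curve /Ck_map continuous_open_subspace//; split=> -[fc fd].
  split=> [t Jt|d Ad]; first by apply: fc; rewrite inE.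
  by have := fd (@id_chart R^o) d erefl Ad; rewrite setE.
split=> [t|c d -> Ad]; first by rewrite inE; exact: fc.
by rewrite setE; exact: fd.
Qed.

Section LieCurves.
Context {R : realType} {E : tvsType R} {G : lieGroupType E}.
Hypothesis hE : hausdorff_space E.
Implicit Types (mu nu : R -> G) (t : R) (g : G) (J : set R).

Lemma shift_continuous t : continuous (fun s : R => t + s).
Proof. by move=> s; apply: cvgD; [exact: cvg_cst|exact: cvg_id]. Qed.

Lemma Ck_curve_translate k J J' mu t g : open J -> open J' ->
  (forall s, J' s -> J (t + s)) -> Ck_curve atlas k J mu ->
  Ck_curve atlas k J' (fun s => mu (t + s) * g)%g.
Proof.
move=> oJ oJ' J'J /(Ck_curveP _ _ _ oJ) [mc md].
have mc' s : J' s -> {for s, continuous (fun s => mu (t + s) * g)%g}.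
  move=> /J'J Js; apply: continuous_mulg; last exact: cst_continuous.
  by apply: (@continuous_comp _ _ _ (fun s => t + s) mu); [exact: shift_continuous|exact: mc].
apply/Ck_curveP => //; split=> // d Ad.
have Ad' := translated_chart_atlas g Ad.
have oU := open_preimage_in oJ mc (open_chart_dom Ad').
have oU' := open_preimage_in oJ' mc' (open_chart_dom Ad).
have cid : continuous (@id R^o) by move=> x B.
have := @Ck_on_affine R R^o R^o E id t (fun _ _ => erefl) (fun _ _ => erefl) cid
  k _ _ oU (md _ Ad').
apply: Ck_on_sub => //; first exact: (open_affine t cid oU).
by move=> s [/J'J Js ds].
Qed.

Variable Xi : chart G E.
Hypothesis hXi : atlas Xi.
Hypothesis Xi_dom : chart_dom Xi 1%g.
Hypothesis Xi_one : Xi 1%g = 0.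

(** The logarithmic derivative at [t], in the coordinates of the Lie algebra. *)
Definition has_log_deriv mu t (l : E) :=
  has_deriv (fun s => Xi (mu (t + s) * (mu t)^-1)%g) 0 l.

Lemma has_deriv_ddiff_real (f : R -> E) t l :
  (diff_quot (F := R^o) f t 1 s @[s --> 0^'] --> l) <-> has_deriv f t l.
Proof.
rewrite (@diff_quotP R R^o E) (_ : (fun s => _) = (fun s => f (t + s))); last first.
  by apply/funext => s; rewrite /GRing.scale/= mulr1.
exact: iff_sym (has_deriv_shift f t l).
Qed.

Lemma curve_derivE (f : R -> E) t l : has_deriv f t l -> curve_deriv f t = l.
Proof.
move=> /has_deriv_ddiff_real h; apply: xget_unique => // l' h'.
exact: (cvg_unique hE h' h).
Qed.

Lemma C1_curve_chart_deriv J mu t d : open J -> Ck_curve atlas (Some 1%N) J mu ->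
  J t -> atlas d -> chart_dom d (mu t) -> exists l, has_deriv (fun s => d (mu s)) t l.
Proof.
move=> oJ /(Ck_curveP _ _ _ oJ) [mc md] Jt Ad dt.
have [l /has_deriv_ddiff_real hl] := C1_ddiff (k := Some 1%N) (1 : R^o) isT (md d Ad) (conj Jt dt).
by exists l.
Qed.

Lemma C1_curve_has_log_deriv J mu t : open J -> Ck_curve atlas (Some 1%N) J mu ->
  J t -> exists l, has_log_deriv mu t l.
Proof.
move=> oJ mC Jt.
have [|l hl] := C1_curve_chart_deriv (d := translated_chart Xi (mu t)^-1%g) oJ mC Jt
  (translated_chart_atlas _ hXi).
  by rewrite /= mulgV.
by exists l; move/has_deriv_shift: hl.
Qed.

Lemma open_symmetric_itv (e : R) : open [set` `]-e, e[].
Proof. exact: interval_open. Qed.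

(** All curves representing the logarithmic derivative have the same velocity
  at the unit, because [Xi] translated to [mu t] is a chart at [mu t]. *)
Lemma dchart_right_log_deriv J mu t l : open J -> Ck_curve atlas (Some 1%N) J mu ->
  J t -> has_log_deriv mu t l -> dchart Xi (right_log_deriv mu t) = l.
Proof.
move=> oJ mC Jt hl.
have [e e0 eJ] : exists2 e : R, 0 < e & forall s, [set` `]-e, e[] s -> J (t + s).
  have /nbhs_ballP[e /= e0 eJ] : nbhs t J by exact: open_nbhs_nbhs.
  exists e => // s; rewrite /= in_itv/= => se; apply: eJ.
  by rewrite /ball/= opprD addrA subrr sub0r normrN ltr_norml.
have germ g : C1_germ atlas (fun s => mu (t + s) * g)%g.
  by exists e => //; apply: Ck_curve_translate eJ mC => //; exact: open_symmetric_itv.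
have germ1 : C1_germ atlas (fun s => mu (t + s)).
  by have := germ 1%g; under eq_fun do rewrite mulg1.
apply: xget_unique.
  exists (fun s => mu (t + s) * (mu t)^-1)%g; last exact: curve_derivE.
  exists (fun s => mu (t + s)); first by split.
  by split; [exact: germ|split].
move=> _ [h [g [_ [g0 gv]] [_ [h0 hv]]] <-].
have g0E : g 0 = mu t by rewrite -g0 addr0.
rewrite -hv //; last by rewrite /right_translation /= g0E mulgV.
have -> : Xi \o (right_translation (mu t)^-1 \o g)%g =
  translated_chart Xi (mu t)^-1%g \o g by [].
rewrite -gv; last 2 first.
- exact: translated_chart_atlas.
- by rewrite /= addr0 mulgV.
exact: curve_derivE.
Qed.

Lemma log_deriv_of_curve (r r' : R) mu (phi : itv_type r r' -> set (R -> G))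
    (t : itv_type r r') : log_deriv_of mu phi ->
  {for val t, continuous mu} /\ has_log_deriv mu (val t) (lie_coord Xi phi t).
Proof.
move=> [[J [oJ _ rJ mC]] phiE].
have Jt : J (val t) by apply: rJ => /=; exact: (valP t).
split; first by have [mc _] := (Ck_curveP _ _ _ oJ).1 mC; exact: mc.
have [l hl] := C1_curve_has_log_deriv oJ mC Jt.
by rewrite /lie_coord phiE (dchart_right_log_deriv oJ mC Jt hl).
Qed.

Lemma near_right_quotient mu t (W : set G) : {for t, continuous mu} -> nbhs 1%g W ->
  \forall s \near (0 : R), W (mu (t + s) * (mu t)^-1)%g.
Proof.
move=> mc W1.
have h : {for t, continuous (fun s => mu s * (mu t)^-1)%g}.
  by apply: continuous_mulg => //; exact: cst_continuous.
apply: ((near_shift t (fun s => W (mu s * (mu t)^-1)%g)).1 _).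
by apply: h; rewrite /= mulgV.
Qed.

(** A continuous curve with a continuous logarithmic derivative [phi] is of class
  C1: in a chart, its derivative at [t] is the value at [phi t] of the
  differential at the unit of the right translation by [mu t], which depends
  continuously on [t]. *)
Lemma C1_curve_of_log_deriv mu (phi : R -> E) : continuous mu -> continuous phi ->
  (forall t, has_log_deriv mu t (phi t)) -> Ck_curve atlas (Some 1%N) setT mu.
Proof.
move=> mc pc ml; apply/Ck_curveP; first exact: openT.
split=> [t _|d Ad]; first exact: mc.
have oU : open ([set: R] `&` mu @^-1` chart_dom d).
  by apply: (open_preimage_in openT _ (open_chart_dom Ad)) => t _; exact: mc.
apply: smooth_Ck_on => //.
have cod0 : chart_cod Xi 0 by rewrite -Xi_one; exact: chart_codP.
have inv0 : chart_inv Xi 0 = 1%g by rewrite -Xi_one chartK.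
have oM := open_chart_mul_dom hXi Ad Ad.
have MC := chart_mul_Ck hXi Ad Ad.
have M0 t : chart_dom d (mu t) -> chart_mul_dom Xi d d (0, d (mu t)).
  by move=> dt; split=> /=; rewrite ?inv0 ?mul1g ?chartK//; split=> //; exact: chart_codP.
exists (fun t => dderiv (phi t, 0) (chart_mul Xi d d) (0, d (mu t))) => t [_ /= dt].
  have h0 : Xi (mu (t + 0) * (mu t)^-1)%g = 0 by rewrite addr0 mulgV.
  have := has_deriv_inl (d (mu t)) (ml t); rewrite -[X in (X, d (mu t))]h0 => hx.
  have := has_deriv_C1_comp (k := None) hE oM isT MC _ hx.
  rewrite h0 => /(_ (M0 t dt)) hd; apply/has_deriv_shift; apply: has_deriv_near hd.
  apply: filterS (near_right_quotient (mc t) (chart_dom_near hXi Xi_dom)) => s ds.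
  by rewrite add0r /chart_mul /= !chartK// mulgVK.
have cd : {for t, continuous (fun s => d (mu s))}.
  apply: (@continuous_comp _ _ _ mu d); [exact: mc|exact: chart_continuous].
have ca : {for t, continuous (fun s => ((0, d (mu s)), (phi s, 0)) : (E * E) * (E * E))}.
  apply: continuous_pair; apply: continuous_pair => //.
  - exact: cst_continuous.
  - exact: pc.
  - exact: cst_continuous.
have := C1_continuous (k := None) (v := (phi t, 0)) oM isT MC (M0 t dt).
by move=> h; exact: (continuous_comp ca h).
Qed.

End LieCurves.
(** * The topology of the domain of the evolution map *)

Section EvolTopology.
Context {R : realType} {E : tvsType R} {G : lieGroupType E}.
Variable Xi : chart G E.
Variables (k : option nat) (r r' : R).
Hypothesis rr' : r < r'.
Local Notation D := (evol_domain Xi k r r').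
Implicit Types (phi psi : D) (p : E -> R).

Lemma in_itv_type (t : R) : r <= t <= r' -> t \in `[r, r'].
Proof. by rewrite in_itv. Qed.

Lemma itv_type_bounds (t : itv_type r r') : r <= val t <= r'.
Proof. by have := valP t; rewrite in_itv. Qed.

Lemma continuous_seminorm_bounded (f : R -> E) p : continuous_seminorm p ->
  (forall t, r <= t <= r' -> {for t, continuous f}) ->
  exists M, forall t, r <= t <= r' -> p (f t) <= M.
Proof.
move=> hp fc.
apply: (@chain_local _ (fun a b => exists M, forall t, a <= t <= b -> p (f t) <= M)).
- exact: ltW.
- move=> a b c _ ab bc _ [M1 h1] [M2 h2]; exists (Num.max M1 M2) => t /andP[ta tc].
  rewrite le_max; case: (leP t b) => tb; first by rewrite h1 ?ta.
  by rewrite h2 ?orbT// tc ltW.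
- move=> t /fc /continuous_seminormP/(_ p hp 1 ltr01) /nbhs_ballP[d /= d0 hd].
  have bd s : `|s - t| < d -> p (f s) <= p (f t) + 1.
    move=> sd; apply: le_trans (seminorm_le_sub _ (f t) hp) _.
    by rewrite lerD2l ltW//; apply: hd; rewrite /ball/= distrC.
  exists d => // s _ sd; split=> st; exists (p (f t) + 1) => x /andP[sx xt]; apply: bd.
    by apply: le_lt_trans sd; rewrite !ler0_norm ?subr_le0//; lra.
  by apply: le_lt_trans sd; rewrite !ger0_norm ?subr_ge0//; lra.
Qed.

Lemma Ck_itv_model_continuous (f : R -> E) t :
  Ck_itv (model_atlas E) k r r' f -> r <= t <= r' -> {for t, continuous f}.
Proof.
move=> [J [oJ _ rJ /(Ck_curveP _ _ _ oJ) [fc _]]] tr; apply: fc; apply: rJ.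
by rewrite /= in_itv.
Qed.

Lemma lie_coord_dist_bounded p phi psi : continuous_seminorm p ->
  has_ubound [set p (lie_coord Xi psi t - lie_coord Xi phi t) | t in [set: itv_type r r']].
Proof.
move=> hp; have [f hf fE] := evol_curve_Ck phi; have [g hg gE] := evol_curve_Ck psi.
have [M1 h1] := continuous_seminorm_bounded hp (fun t => Ck_itv_model_continuous hf).
have [M2 h2] := continuous_seminorm_bounded hp (fun t => Ck_itv_model_continuous hg).
exists (M2 + M1) => _ [t _ <-]; rewrite fE gE.
apply: le_trans (seminorm_add _ _ hp) _; rewrite seminormN//.
by rewrite lerD ?h1 ?h2 ?itv_type_bounds.
Qed.

Lemma sup_seminorm_ub p phi psi (t : itv_type r r') : continuous_seminorm p ->
  p (lie_coord Xi psi t - lie_coord Xi phi t) <=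
  sup_seminorm p (fun t => lie_coord Xi psi t - lie_coord Xi phi t).
Proof.
by move=> hp; apply: ub_le_sup; [exact: lie_coord_dist_bounded|exists t].
Qed.

Lemma sup_seminorm_le p (f : itv_type r r' -> E) (e : R) :
  (forall t, p (f t) <= e) -> sup_seminorm p f <= e.
Proof.
move=> h; apply: ge_sup => [|_ [t _ <-]//].
have r0 : r \in `[r, r'] by rewrite in_itv/= lexx ltW.
by exists (p (f (exist _ r r0))); exists (exist _ r r0).
Qed.

Lemma seminorm_ball_nbhs p phi (e : R) : continuous_seminorm p -> 0 < e ->
  nbhs phi (seminorm_ball p phi e).
Proof.
move=> hp e0; apply: open_nbhs_nbhs; split; last first.
  rewrite /seminorm_ball /=; apply: le_lt_trans e0.
  by apply: sup_seminorm_le => t; rewrite subrr seminorm0.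
exists [set seminorm_ball p phi e]; last exact: bigcup_set1.
move=> _ ->; have hB : (@seminorm_balls R E G Xi k r r') (seminorm_ball p phi e).
  by exists p, phi, e.
exact: (finI_from1 id hB).
Qed.

(** Finitely many balls of the subbasis contain [phi], possibly centred elsewhere;
  the triangle inequality yields a ball centred at [phi] inside all of them. *)
Lemma evol_domain_nbhs phi (W : set D) : nbhs phi W ->
  exists p (e : R), [/\ continuous_seminorm p, 0 < e & forall psi,
    (forall t, p (lie_coord Xi psi t - lie_coord Xi phi t) <= e) -> W psi].
Proof.
rewrite nbhsE => -[B [oB Bphi] BW].
have [D' D'D D'B] : exists2 D' : set (set D),
    D' `<=` finI_from (@seminorm_balls R E G Xi k r r') id & \bigcup_(i in D') i = B.
  exact: oB.
have [i D'i iphi] : (\bigcup_(i in D') i) phi by rewrite D'B.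
have [A AD Ai] := D'D _ D'i.
have iB : i `<=` B by rewrite -D'B => x ix; exists i.
suff [p [e [hp e0 h]]] : exists p (e : R), [/\ continuous_seminorm p, 0 < e &
    forall psi, (forall t, p (lie_coord Xi psi t - lie_coord Xi phi t) <= e) ->
    forall j, j \in finmap.enum_fset A -> j psi].
  exists p, e; split=> // psi /h hpsi; apply/BW/iB; rewrite -Ai => j Aj.
  exact: hpsi.
have {AD Ai}Aphi j : j \in finmap.enum_fset A -> seminorm_balls j /\ j phi.
  move=> jA; split; first by have := AD j jA; rewrite inE.
  by move: iphi; rewrite -Ai; apply.
move: (finmap.enum_fset A) Aphi; elim=> [|j s IH] Aphi.
  by exists (fun=> 0), 1; split=> //; exact: zero_seminorm.
have [p [e [hp e0 h]]] : exists p (e : R), [/\ continuous_seminorm p, 0 < e &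
    forall psi, (forall t, p (lie_coord Xi psi t - lie_coord Xi phi t) <= e) ->
    forall j, j \in s -> j psi].
  by apply: IH => i' i's; apply: Aphi; rewrite inE i's orbT.
have [[q [phi1 [e1 [hq e10 ->]]]] jphi] := Aphi j (mem_head _ _).
move: jphi; rewrite /seminorm_ball /=; set S := sup_seminorm _ _ => Se.
have d0 : 0 < (e1 - S) / 2 by rewrite divr_gt0// subr_gt0.
exists (fun x => p x + q x), (Num.min e ((e1 - S) / 2)); split.
- exact: seminormD.
- by rewrite lt_min e0.
move=> psi hpsi j'; rewrite inE => /orP[/eqP ->|]; last first.
  apply: h => t; apply: le_trans (le_trans (hpsi t) _); first by rewrite lerDl seminorm_ge0.
  by rewrite ge_min lexx.
rewrite /=; apply: (@le_lt_trans _ _ (S + (e1 - S) / 2)); last by lra.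
apply: sup_seminorm_le => t.
apply: le_trans (seminorm_sub _ (lie_coord Xi phi t) _ hq) _; rewrite addrC lerD//.
  exact: sup_seminorm_ub.
apply: le_trans (le_trans (hpsi t) _); first by rewrite lerDr seminorm_ge0.
by rewrite ge_min lexx orbT.
Qed.

Lemma evol_curveP phi : exists2 mu, log_deriv_of mu phi &
  evol phi = (mu r' * (mu r)^-1)%g.
Proof.
have [mu hmu] := evol_curve_log phi.
have [nu hnu nuE] := @xgetPex G 1%g
  [set (mu r' * (mu r)^-1)%g | mu in [set mu | log_deriv_of mu phi]]
  (ex_intro _ _ (ex_intro2 _ _ mu hmu erefl)).
by exists nu.
Qed.

End EvolTopology.

Section LiePath.
Context {R : realType} {E : tvsType R} {G : lieGroupType E}.
Hypothesis hE : hausdorff_space E.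
Variable Xi : chart G E.
Hypothesis hXi : atlas Xi.
Hypothesis Xi_dom : chart_dom Xi 1%g.
Variables (r r' : R).

(** The zero extension lets the estimates be stated for curves on the line. *)
Definition lie_path (phi : itv_type r r' -> set (R -> G)) (t : R) : E :=
  if pselect (r <= t <= r') is left tr then
    lie_coord Xi phi (exist _ t (in_itv_type tr)) else 0.

Lemma lie_pathE phi (t : R) (tr : r <= t <= r') :
  lie_path phi t = lie_coord Xi phi (exist _ t (in_itv_type tr)).
Proof.
by rewrite /lie_path; case: pselect => // tr'; congr (lie_coord _ _ _); exact: val_inj.
Qed.

Lemma log_deriv_of_path (mu : R -> G) phi (t : R) : log_deriv_of mu phi ->
  r <= t <= r' -> {for t, continuous mu} /\ has_log_deriv Xi mu t (lie_path phi t).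
Proof.
move=> hmu tr; rewrite lie_pathE.
exact: (log_deriv_of_curve hE hXi Xi_dom (exist _ t (in_itv_type tr)) hmu).
Qed.

End LiePath.

(** * Local mu-convexity implies continuity of the evolution maps *)

Section ConvexImpliesContinuous.
Context {R : realType} {E : tvsType R} {G : lieGroupType E}.
Hypothesis hE : hausdorff_space E.
Variable Xi : chart G E.
Hypothesis hXi : atlas Xi.
Hypothesis Xi_dom : chart_dom Xi 1%g.
Hypothesis Xi_one : Xi 1%g = 0.

Lemma mulg_nbhs (x0 y0 : G) (W : set G) : nbhs (x0 * y0)%g W ->
  exists A B, [/\ nbhs x0 A, nbhs y0 B & forall x y, A x -> B y -> W (x * y)%g].
Proof.
move=> /(@mulg_continuous R E G (x0, y0)) [[A B] /= [hA hB] AB].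
by exists A, B; split=> // x y Ax By; exact: (AB (x, y)).
Qed.

Lemma invg_nbhs (x0 : G) (W : set G) : nbhs (x0^-1)%g W ->
  nbhs x0 [set x | W (x^-1)%g].
Proof. exact: (@invg_continuous R E G x0). Qed.

(** The conjugates of [a^-1 * b] by [g] are trivial for [a = b], so that the Lipschitz
  estimates for the multiplication bound them by the distance of [a] and [b]. *)
Lemma conj_quotient_lipschitz (g0 : G) (o : E -> R) : continuous_seminorm o ->
  exists2 q : E -> R, continuous_seminorm q &
    exists N N' : set G, [/\ nbhs g0 N, nbhs 1%g N' &
      forall g a b, N g -> N' a -> N' b ->
        chart_dom Xi (g^-1 * (a^-1 * b * g))%g /\
        o (Xi (g^-1 * (a^-1 * b * g))%g) <= q (Xi b - Xi a)].
Proof.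
move=> ho; have [c hc cg] := chart_at g0.
have hc' := inv_chart_atlas hc; have hXi' := inv_chart_atlas hXi.
have cg' : chart_dom (inv_chart c) g0^-1%g by rewrite /= invgK.
have Xi'1 : chart_dom (inv_chart Xi) 1%g by rewrite /= invg1.
have [|q3 hq3 [A3 [B3 [nA3 nB3 dA3 dB3 L3]]]] :=
  mulg_lipschitz hE hc' hc hXi cg' cg _ ho; first by rewrite mulVg.
have [|q2 hq2 [A2 [B2 [nA2 nB2 dA2 dB2 L2]]]] :=
  mulg_lipschitz hE hXi hc hc Xi_dom cg _ hq3; first by rewrite mul1g.
have [|q1 hq1 [A1 [B1 [nA1 nB1 dA1 dB1 L1]]]] :=
  mulg_lipschitz hE hXi' hXi hXi Xi'1 Xi_dom _ hq2; first by rewrite mul1g.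
have nB3' : nbhs (1 * g0)%g B3 by rewrite mul1g.
have [A4 [B4 [nA4 nB4 h4]]] := mulg_nbhs nB3'.
have nA24 : nbhs (1^-1 * 1)%g (A2 `&` A4) by rewrite mulVg; exact: filterI.
have [A5 [B5 [nA5 nB5 h5]]] := mulg_nbhs nA24.
have nA1' : nbhs 1%g [set x : G | A1 x^-1%g] by apply: invg_nbhs; rewrite invg1.
exists q1 => //.
exists ((B2 `&` B3) `&` (B4 `&` [set x | A3 x^-1%g])).
exists (([set x | A1 x^-1%g] `&` B1) `&` ([set x | A5 x^-1%g] `&` B5)).
split.
- apply: filterI; first exact: filterI.
  by apply: filterI => //; exact: invg_nbhs.
- apply: filterI; first exact: filterI.
  by apply: filterI => //; exact: invg_nbhs.
move=> g a b [[B2g B3g] [B4g A3g]] [[A1a B1a] [A5a B5a]] [[A1b B1b] [A5b B5b]].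
have [A2k A4k] := h5 _ _ A5a B5b.
have A21 : A2 1%g by exact: nbhs_singleton.
have B3kg := h4 _ _ A4k B4g.
have [d3 e3] := L3 _ _ _ _ A3g A3g B3kg B3g.
have [_ e2] := L2 _ _ _ _ A2k A21 B2g B2g.
have [_ e1] := L1 _ _ _ _ A1a A1a B1b B1a.
split=> //.
rewrite mulVg Xi_one subr0 !subrr seminorm0// add0r in e3.
rewrite mul1g Xi_one subr0 subrr (seminorm0 hq2) addr0 in e2.
rewrite mulVg Xi_one subr0 subrr (seminorm0 hq1) add0r in e1.
exact: le_trans e3 (le_trans e2 e1).
Qed.

Definition conj_quotient_bound (g : G) (o q : E -> R) := exists2 N' : set G,
  nbhs 1%g N' & forall a b, N' a -> N' b ->
    chart_dom Xi (g^-1 * (a^-1 * b * g))%g /\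
    o (Xi (g^-1 * (a^-1 * b * g))%g) <= q (Xi b - Xi a).

Lemma conj_quotient_bound_le g (o q q' : E -> R) : (forall x, q x <= q' x) ->
  conj_quotient_bound g o q -> conj_quotient_bound g o q'.
Proof.
move=> qq' [N' nN' h]; exists N' => // a b Na Nb.
by have [d le] := h a b Na Nb; split=> //; exact: le_trans le (qq' _).
Qed.

(** By compactness, one seminorm serves along a whole curve. *)
Lemma conj_quotient_bound_curve (mu : R -> G) (r r' : R) (o : E -> R) : r <= r' ->
  continuous_seminorm o -> (forall t, r <= t <= r' -> {for t, continuous mu}) ->
  exists2 q : E -> R, continuous_seminorm q &
    forall t, r <= t <= r' -> conj_quotient_bound (mu t) o q.
Proof.
move=> rr' ho mc.
apply: (@chain_local _ (fun a b => exists2 q : E -> R, continuous_seminorm q &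
  forall t, a <= t <= b -> conj_quotient_bound (mu t) o q)) => //.
  move=> a b c _ ab bc _ [q1 hq1 h1] [q2 hq2 h2].
  exists (fun x => q1 x + q2 x); first exact: seminormD.
  move=> t /andP[ta tc]; case: (leP t b) => tb.
    apply: (@conj_quotient_bound_le _ _ q1); last by apply: h1; rewrite ta.
    by move=> x; rewrite lerDl seminorm_ge0.
  apply: (@conj_quotient_bound_le _ _ q2); last by apply: h2; rewrite tc ltW.
  by move=> x; rewrite lerDr seminorm_ge0.
move=> t /mc mct; have [q hq [N [N' [nN nN' h]]]] := conj_quotient_lipschitz (mu t) ho.
have /nbhs_ballP[d /= d0 hd] : \forall s \near t, N (mu s) by exact: mct.
have bd s : `|s - t| < d -> conj_quotient_bound (mu s) o q.
  move=> sd; exists N' => // a b Na Nb; apply: h => //.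
  by apply: hd; rewrite /ball/= distrC.
exists d => // s _ sd; split=> st; exists q => // x /andP[sx xt]; apply: bd.
  by apply: le_lt_trans sd; rewrite !ler0_norm ?subr_le0//; lra.
by apply: le_lt_trans sd; rewrite !ger0_norm ?subr_ge0//; lra.
Qed.

(** In a short time the quotient [mu^-1 * nu] moves by a conjugate of the kind
  estimated above, hence by the chart image of a vector whose length is at most
  [eta] times the duration; these lengths add up along a subdivision. *)
Lemma quotient_factorization (mu nu : R -> G) (phi psi : R -> E) (r r' eta : R)
    (o q : E -> R) : r <= r' -> continuous_seminorm q ->
  (forall t, r <= t <= r' -> {for t, continuous mu}) ->
  (forall t, r <= t <= r' -> {for t, continuous nu}) ->
  (forall t, r <= t <= r' -> has_log_deriv Xi mu t (phi t)) ->
  (forall t, r <= t <= r' -> has_log_deriv Xi nu t (psi t)) ->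
  (forall t, r <= t <= r' -> conj_quotient_bound (mu t) o q) ->
  (forall t, r <= t <= r' -> q (psi t - phi t) < eta) ->
  exists Xs : seq E, [/\ (0 < size Xs)%N, \sum_(X <- Xs) o X <= eta * (r' - r) &
    ((mu r')^-1 * nu r' * ((nu r)^-1 * mu r))%g =
    (\prod_(X <- Xs) chart_inv Xi X)%g].
Proof.
move=> rr' hq mc nc ml nl hb hlt.
apply: (@chain_near _ (fun s t => exists Xs : seq E, [/\ (0 < size Xs)%N,
  \sum_(X <- Xs) o X <= eta * (t - s) &
  ((mu t)^-1 * nu t * ((nu s)^-1 * mu s))%g = (\prod_(X <- Xs) chart_inv Xi X)%g])) => //.
  move=> a b c _ _ _ _ [X1 [s1 l1 p1]] [X2 [s2 l2 p2]]; exists (X2 ++ X1); split.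
  - by rewrite size_cat addn_gt0 s1 orbT.
  - rewrite big_cat /=; have -> : eta * (c - a) = eta * (c - b) + eta * (b - a) by ring.
    exact: lerD.
  - rewrite big_cat /= -p1 -p2 !mulgA; congr (_ * _ * _)%g.
    by rewrite -(mulgA _ (mu b)) mulgV mulg1 -(mulgA _ (nu b)^-1%g) mulVg mulg1.
move=> t tr; have [N' nN' bound] := hb t tr.
have qs : \forall s \near (0 : R),
    q (Xi (nu (t + s) * (nu t)^-1)%g - Xi (mu (t + s) * (mu t)^-1)%g) <= eta * `|s|.
  have hd := has_derivB (nl t tr) (ml t tr).
  have := has_deriv_le hq (hlt t tr) hd; apply: filterS => s.
  by rewrite add0r addr0 !mulgV subrr subr0.
apply: filterS2 (filterI (near_right_quotient (mc t tr) nN')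
  (near_right_quotient (nc t tr) nN')) qs => s [Na Nb] qs _.
set a := (mu (t + s) * (mu t)^-1)%g in Na qs *.
set b := (nu (t + s) * (nu t)^-1)%g in Nb qs *.
have kE : ((mu t)^-1 * (a^-1 * b * mu t) =
    (mu (t + s))^-1 * nu (t + s) * ((nu t)^-1 * mu t))%g.
  by rewrite /a /b invgM invgK !mulgA mulVg mul1g.
have kE' : ((mu t)^-1 * (b^-1 * a * mu t) =
    (mu t)^-1 * nu t * ((nu (t + s))^-1 * mu (t + s)))%g.
  by rewrite /a /b invgM invgK !mulgA mulgVK.
split=> s0.
  have [d le] := bound b a Nb Na.
  exists [:: Xi ((mu t)^-1 * (b^-1 * a * mu t))%g]; rewrite !big_seq1 chartK//.
  split=> //; apply: le_trans le _; rewrite seminormBC//.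
  by have -> : t - (t + s) = `|s| by rewrite ler0_norm//; ring.
have [d le] := bound a b Na Nb.
exists [:: Xi ((mu t)^-1 * (a^-1 * b * mu t))%g]; rewrite !big_seq1 chartK//.
split=> //; apply: le_trans le _.
by have -> : t + s - t = `|s| by rewrite ger0_norm//; ring.
Qed.

Lemma mu_convex_seq (u o : E -> R) :
  (forall (n : nat) (X : 'I_n -> E), (0 < n)%N -> \sum_(i < n) o (X i) <= 1 ->
    [/\ forall i, chart_cod Xi (X i),
        chart_dom Xi (\prod_(i < n) chart_inv Xi (X i))%g &
        u (Xi (\prod_(i < n) chart_inv Xi (X i))%g) <= \sum_(i < n) o (X i)]) ->
  forall Xs : seq E, (0 < size Xs)%N -> \sum_(X <- Xs) o X <= 1 ->
    chart_dom Xi (\prod_(X <- Xs) chart_inv Xi X)%g /\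
    u (Xi (\prod_(X <- Xs) chart_inv Xi X)%g) <= \sum_(X <- Xs) o X.
Proof.
move=> h Xs s0.
have -> : \sum_(X <- Xs) o X = \sum_(i < size Xs) o (nth 0 Xs i).
  by rewrite (big_nth 0) big_mkord.
have -> : (\prod_(X <- Xs) chart_inv Xi X)%g =
    (\prod_(i < size Xs) chart_inv Xi (nth 0 Xs i))%g.
  by rewrite (big_nth 0) big_mkord.
move=> le1; by have [] := h (size Xs) (fun i => nth 0 Xs i) s0 le1.
Qed.

(** For [psi] near [phi] in the seminorm bounding the conjugated quotients, the
  quotient of the two motions is a product of chart images of total length at
  most [1 / 2], which local mu-convexity keeps near the unit. *)
Theorem convex_continuous k : locally_mu_convex Xi -> zero_k_continuous Xi k.
Proof.
move=> mconv r r' rr' phi W.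
have [mu hmu evE] := evol_curveP phi; rewrite evE => nW.
have mint t := log_deriv_of_path hE hXi Xi_dom (t := t) hmu.
have nW' : nbhs 1%g [set x : G | W (mu r' * x * (mu r)^-1)%g].
  have := @continuous_mulg R E G G (fun x => mu r' * x)%g (fun _ => (mu r)^-1)%g 1%g.
  move=> h; apply: h; last by rewrite /= mulg1.
    by apply: continuous_mulg => [|B //]; exact: cst_continuous.
  exact: cst_continuous.
have [p hp pW] := chart_nbhs hXi Xi_dom nW'; rewrite Xi_one in pW.
have [om [hom _ hconv]] := mconv p hp; have oconv := mu_convex_seq hconv.
have mc t : r <= t <= r' -> {for t, continuous mu}.
  by move=> tr; have [] := mint t tr.
have [q hq hb] := conj_quotient_bound_curve (ltW rr') hom mc.
pose eta := (2 * (r' - r))^-1.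
have rr0 : 0 < r' - r by rewrite subr_gt0.
have eta0 : 0 < eta by rewrite invr_gt0 mulr_gt0.
apply: filterS (seminorm_ball_nbhs rr' phi hq eta0) => psi /= psiball.
have [nu hnu ->] := evol_curveP psi.
have nint t := log_deriv_of_path hE hXi Xi_dom (t := t) hnu.
have [|t tr|t tr|t tr|Xs [s0 sumo prodE]] := @quotient_factorization mu nu
  (lie_path Xi phi) (lie_path Xi psi) r r' eta om q (ltW rr') hq mc _ _ _ hb.
- by move=> t tr; have [] := nint t tr.
- by have [] := mint t tr.
- by have [] := nint t tr.
- by rewrite !lie_pathE; apply: le_lt_trans psiball; exact: sup_seminorm_ub.
have le2 : \sum_(X <- Xs) om X <= 2^-1.
  apply: le_trans sumo _; rewrite /eta invfM -mulrA mulVf ?mulr1//.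
  by rewrite gt_eqF.
have half1 : (2^-1 : R) < 1 by rewrite invf_lt1// ltr1n.
have [dX leX] := oconv Xs s0 (le_trans le2 (ltW half1)).
have := pW (Xi (\prod_(X <- Xs) chart_inv Xi X)%g).
rewrite subr0 => /(_ (le_lt_trans (le_trans leX le2) half1)) [_].
by rewrite chartK// -prodE /= !mulgA mulgV mul1g mulgK.
Qed.

End ConvexImpliesContinuous.
(** * A smooth step function *)

Section SmoothStep.
Context {R : realType}.
Implicit Types (t s : R) (k n : nat).

Local Notation deriv_at f := (has_deriv (E := R^o) f).
Local Notation smooth_real n := (smooth (E := R^o) n).

Lemma is_derive_has_deriv (f : R -> R) t l : is_derive t 1 f l -> deriv_at f t l.
Proof.
move=> [df fl]; apply/has_deriv_cvgP; rewrite -fl.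
have := df; rewrite /derivable /derive.
rewrite (_ : (fun h => h^-1 *: _) =
  (fun s : R => s^-1 *: (f (t + s) - f t : R^o))) //.
by apply/funext => s; congr (_ *: (f _ - _)); rewrite /= /GRing.scale /= mulr1 addrC.
Qed.

Lemma has_deriv_mul (f g : R -> R) t l l' : deriv_at f t l -> deriv_at g t l' ->
  deriv_at (fun s => f s * g s) t (l * g t + f t * l').
Proof. exact: (@has_deriv_scale R R^o). Qed.

Lemma has_deriv_inv t : t != 0 -> deriv_at (fun s => s^-1) t (- (t^-1 * t^-1)).
Proof.
move=> t0; apply: is_derive_has_deriv.
have := @is_deriveV R id t 1 1 t0 (is_derive_id t 1).
by rewrite /GRing.scale /= mulr1 expr2 invfM.
Qed.

Lemma has_deriv_real_unique (f : R -> R) t l l' : deriv_at f t l -> deriv_at f t l' -> l = l'.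
Proof. by apply: (@has_deriv_unique R R^o); exact: (@norm_hausdorff R R^o). Qed.

Lemma smooth_mul n (U : set R) (f g : R -> R) :
  smooth_real n U f -> smooth_real n U g -> smooth_real n U (fun t => f t * g t).
Proof. exact: (@smooth_scale R R^o). Qed.

Lemma smooth_id n U : smooth_real n U (fun t => t).
Proof.
case: n => [|n] /=; first by move=> t _ B.
by exists (fun _ => 1); [move=> t _; exact: has_deriv_ident|exact: smooth_cst].
Qed.

Lemma smooth_inv n : smooth_real n [set t | t != 0] (fun t => t^-1).
Proof.
elim: n => [|n IH] /=.
  by move=> t t0; exact: (has_deriv_continuous (has_deriv_inv t0)).
exists (fun t => (-1) * (t^-1 * t^-1)).
  by move=> t t0; rewrite mulN1r; exact: has_deriv_inv.
by apply: smooth_mul; [exact: smooth_cst|exact: smooth_mul].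
Qed.

(** The functions [t^-k * exp (- 1 / t)] continued by zero: they are closed under
  differentiation up to linear combinations, hence all smooth. *)
Definition flat k t : R := if 0 < t then t^-1 ^+ k * expR (- t^-1) else 0.

Lemma flat_le0 k t : t <= 0 -> flat k t = 0.
Proof. by rewrite /flat ltNge => ->. Qed.

Lemma flat_ge0 k t : 0 <= flat k t.
Proof.
rewrite /flat; case: ifP => // t0.
by rewrite mulr_ge0 ?expR_ge0// exprn_ge0// invr_ge0 ltW.
Qed.

Lemma flat_gt0 t : 0 < t -> 0 < flat 0 t.
Proof. by rewrite /flat => ->; rewrite expr0 mul1r expR_gt0. Qed.

Lemma flat_le_sqr k t : flat k t <= (k.+2)`!%:R * (t * t).
Proof.
rewrite /flat; case: ifP => [t0|_]; last first.
  by rewrite mulr_ge0// ?ler0n// -expr2 sqr_ge0.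
have x0 : 0 < t^-1 by rewrite invr_gt0.
have h : t^-1 ^+ k.+2 / (k.+2)`!%:R <= expR t^-1.
  apply: le_trans (expR_ge1Dxn k.+1 (ltW x0)); rewrite lerDr//.
have f0 : (0 : R) < (k.+2)`!%:R by rewrite ltr0n fact_gt0.
rewrite expRN ler_pdivrMr ?expR_gt0//.
apply: le_trans (_ : _ <= (k.+2)`!%:R * (t * t) * (t^-1 ^+ k.+2 / (k.+2)`!%:R)) _.
  rewrite !exprS le_eqVlt; apply/orP; left; apply/eqP.
  have t1 : t * t^-1 = 1 by rewrite divff// gt_eqF.
  have f1 : (k.+2)`!%:R * ((k.+2)`!%:R)^-1 = 1 :> R by rewrite divff// gt_eqF.
  rewrite -[LHS]mul1r -{1}f1 -[in LHS](mul1r (t^-1 ^+ k)) -{1}t1.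
  rewrite -[in LHS](mul1r (t * t^-1)) -{1}t1; ring.
by rewrite ler_wpM2l// mulr_ge0// ?ler0n// -expr2 sqr_ge0.
Qed.

Lemma has_deriv_invX k t : t != 0 -> deriv_at (fun s => s^-1 ^+ k) t (- k%:R * t^-1 ^+ k.+1).
Proof.
move=> t0; elim: k => [|k IH].
  rewrite oppr0 mul0r; apply: (@has_deriv_near R R^o) (has_deriv_cst (E := R^o) t 1).
  by near=> s; rewrite expr0.
have := has_deriv_mul (has_deriv_inv t0) IH; rewrite (_ : _ + _ = - k.+1%:R * t^-1 ^+ k.+2).
  by apply: has_deriv_near; near=> s; rewrite -exprS.
by rewrite -natr1 !exprS; ring.
Unshelve. all: by end_near. Qed.

Lemma has_deriv_flat k t : deriv_at (flat k) t ((- k%:R) * flat k.+1 t + flat k.+2 t).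
Proof.
have [t0|t0|t0] := ltgtP t 0.
- rewrite !flat_le0 ?ltW// mulr0 addr0.
  apply: (@has_deriv_near R R^o) (has_deriv_cst (E := R^o) t 0).
  apply: ((near_shift t (fun s => 0 = flat k s)).1 _).
  have : \forall s \near t, s < 0 by exact: lt_nbhsl.
  by apply: filterS => s s0; rewrite flat_le0// ltW.
- have tn0 : t != 0 by rewrite gt_eqF.
  have h1 : deriv_at (fun s => - s^-1) t (t^-1 * t^-1).
    have := has_derivB (has_deriv_cst (E := R^o) t 0) (has_deriv_inv tn0).
    rewrite sub0r opprK; apply: has_deriv_near; near=> s; exact: sub0r.
  have h2 := @has_deriv_comp R R^o expR (fun s => - s^-1) t _ _ h1
    (is_derive_has_deriv (is_derive_expR (- t^-1))).
  have := has_deriv_mul (has_deriv_invX k tn0) h2.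
  rewrite (_ : _ + _ = - k%:R * flat k.+1 t + flat k.+2 t).
    apply: has_deriv_near.
    apply: ((near_shift t (fun s => s^-1 ^+ k * expR (- s^-1) = flat k s)).1 _).
    have : \forall s \near t, 0 < s by exact: lt_nbhsr.
    by apply: filterS => s s0; rewrite /flat s0.
  by rewrite /flat t0 /GRing.scale /= !exprS; ring.
- rewrite t0 !flat_le0// mulr0 addr0; apply/has_deriv_realP => e e0.
  have c0 : (0 : R) < (k.+2)`!%:R by rewrite ltr0n fact_gt0.
  apply: filterS (near0_normlt (divr_gt0 e0 c0)) => s hs.
  rewrite add0r [flat k 0]flat_le0// subr0 mulr0 subr0 ger0_norm ?flat_ge0//.
  apply: le_trans (flat_le_sqr k s) _; rewrite -expr2 -real_normK ?num_real// expr2.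
  rewrite mulrA ler_wpM2r// mulrC -ler_pdivlMr//; exact: ltW.
Unshelve. all: by end_near. Qed.

Lemma smooth_flat n k : smooth_real n setT (flat k).
Proof.
elim: n k => [|n IH] k /=; first by move=> t _; exact: (has_deriv_continuous (has_deriv_flat k t)).
exists (fun t => (- k%:R) * flat k.+1 t + flat k.+2 t).
  by move=> t _; exact: has_deriv_flat.
by apply: smoothD => //; apply: smooth_mul => //; exact: smooth_cst.
Qed.

Definition step t : R := flat 0 t / (flat 0 t + flat 0 (1 - t)).

Let step_denom t : flat 0 t + flat 0 (1 - t) != 0.
Proof.
rewrite gt_eqF//; case: (leP t 0) => t0; last by rewrite ltr_wpDr ?flat_ge0 ?flat_gt0.
by rewrite ltr_wpDl ?flat_ge0 ?flat_gt0// subr_gt0 (le_lt_trans t0).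
Qed.

Lemma step_le0 t : t <= 0 -> step t = 0.
Proof. by move=> t0; rewrite /step (flat_le0 _ t0) mul0r. Qed.

Lemma step_ge1 t : 1 <= t -> step t = 1.
Proof.
move=> t1; have := step_denom t; rewrite /step [flat 0 (1 - t)]flat_le0 ?subr_le0//.
by rewrite addr0 => /divff.
Qed.

Lemma step_01 t : 0 <= step t <= 1.
Proof.
have d0 : 0 < flat 0 t + flat 0 (1 - t).
  by rewrite lt_neqAle eq_sym step_denom addr_ge0 ?flat_ge0.
rewrite /step divr_ge0 ?flat_ge0 ?(ltW d0)//=.
by rewrite ler_pdivrMr// mul1r lerDl flat_ge0.
Qed.

Lemma smooth_step n : smooth_real n setT step.
Proof.
apply: smooth_mul; first exact: smooth_flat.
have sd : smooth_real n setT (fun t => flat 0 t + flat 0 (1 - t)).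
  apply: smoothD; first exact: smooth_flat.
  apply: (@smooth_comp R R^o n setT setT (fun t => 1 - t)) => //.
    have : smooth_real n setT (fun t => 1 + (-1) * t).
      apply: smoothD; first exact: smooth_cst.
      by apply: smooth_mul; [exact: smooth_cst|exact: smooth_id].
    by apply: smooth_congr => [|t _]; [exact: openT|rewrite mulN1r].
  exact: smooth_flat.
exact: (@smooth_comp R R^o n setT [set t | t != 0] _ _ sd (fun t _ => step_denom t)
  (smooth_inv n)).
Qed.

(** The step is constant outside of the unit interval, and compactness bounds its
  derivative inside. *)
Lemma step_deriv : exists (step' : R -> R) (C : R),
  [/\ forall t, deriv_at step t (step' t), forall n, smooth_real n setT step',
      forall t, t <= 0 \/ 1 <= t -> step' t = 0, 0 < C & forall t, `|step' t| <= C].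
Proof.
have [f' hf' _] := smooth_step 1.
have fd t : deriv_at step t (f' t) by exact: hf'.
have f's n : smooth_real n setT f'.
  have [g hg gs] := smooth_step n.+1; rewrite (_ : f' = g)//.
  by apply/funext => t; apply: has_deriv_real_unique (fd t) _; exact: hg.
have fc t : {for t, continuous (f' : R -> R^o)} by exact: (smooth_continuous (f's 0%N)).
have f'lt0 t : t < 0 -> f' t = 0.
  move=> t0; apply: has_deriv_real_unique (fd t) _.
  apply: (@has_deriv_near R R^o) (has_deriv_cst (E := R^o) t 0).
  apply: ((near_shift t (fun s => 0 = step s)).1 _).
  have : \forall s \near t, s < 0 by exact: lt_nbhsl.
  by apply: filterS => s s0; rewrite step_le0// ltW.
have f'gt1 t : 1 < t -> f' t = 0.
  move=> t0; apply: has_deriv_real_unique (fd t) _.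
  apply: (@has_deriv_near R R^o) (has_deriv_cst (E := R^o) t 1).
  apply: ((near_shift t (fun s => 1 = step s)).1 _).
  have : \forall s \near t, 1 < s by exact: lt_nbhsr.
  by apply: filterS => s s0; rewrite step_ge1// ltW.
(* By continuity the derivative vanishes at the endpoints as well. *)
have limit0 (t d : R) : d != 0 -> (forall s : R, 0 < s -> f' (t + s * d) = 0) -> f' t = 0.
  move=> d0 h; apply/eqP; rewrite -normr_le0; apply/ler_addgt0Pr => e e0; rewrite add0r.
  have := (@continuous_seminormP R R^o R f' t).1 (fc t) _ norm_seminorm e e0.
  move=> /nbhs_ballP [r /= r0 hr].
  have nd : 0 < `|d| by rewrite normr_gt0.
  have s0 : 0 < r / (2 * `|d|) by rewrite divr_gt0// mulr_gt0.
  have := hr (t + r / (2 * `|d|) * d); rewrite h// sub0r normrN => /(_ _)/ltW; apply.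
  rewrite /ball/= opprD addrA subrr sub0r normrN normrM gtr0_norm//.
  rewrite invfM -!mulrA mulVf ?gt_eqF// mulr1 ltr_pdivrMr// ltr_pMr// ltr1n.
  by [].
have [M hM] := @continuous_seminorm_bounded R R^o 0 1 ltr01 f' _ norm_seminorm
  (fun t _ => fc t).
exists f', (Num.max M 1); split => //.
- move=> t [t0|t1].
    apply: (limit0 t (-1)); first by rewrite oppr_eq0 oner_eq0.
    by move=> s s0; apply: f'lt0; rewrite mulrN1 subr_lt0 (le_lt_trans t0).
  apply: (limit0 t 1); first by rewrite oner_eq0.
  by move=> s s0; apply: f'gt1; rewrite mulr1 (le_lt_trans t1)// ltrDl.
- by rewrite lt_max ltr01 orbT.
move=> t; case: (ltP t 0) => t0; first by rewrite f'lt0// normr0 le_max ler01 orbT.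
case: (ltP 1 t) => t1; first by rewrite f'gt1// normr0 le_max ler01 orbT.
by rewrite le_max hM// t0.
Qed.

End SmoothStep.
(** * The evolution map is determined by the logarithmic derivative *)

Section Uniqueness.
Context {R : realType} {E : tvsType R} {G : lieGroupType E}.
Hypothesis hE : hausdorff_space E.
Variable Xi : chart G E.
Hypothesis hXi : atlas Xi.
Hypothesis Xi_dom : chart_dom Xi 1%g.
Hypothesis Xi_one : Xi 1%g = 0.

(** The curve [mu^-1 * nu] has zero derivative, in the chart [Xi] translated to
  any of its points; hence it is constant. *)
Lemma quotient_constant (mu nu : R -> G) (phi : R -> E) (r r' : R) : r <= r' ->
  (forall t, r <= t <= r' -> {for t, continuous mu}) ->
  (forall t, r <= t <= r' -> {for t, continuous nu}) ->
  (forall t, r <= t <= r' -> has_log_deriv Xi mu t (phi t)) ->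
  (forall t, r <= t <= r' -> has_log_deriv Xi nu t (phi t)) ->
  ((mu r')^-1 * nu r' = (mu r)^-1 * nu r)%g.
Proof.
move=> rr' mc nc ml nl.
pose alpha t := ((mu t)^-1 * nu t)%g.
have ac t : r <= t <= r' -> {for t, continuous alpha}.
  by move=> tr; apply: continuous_mulg (nc t tr); apply: continuous_invg; exact: mc.
have small t u (e : R) : r <= t <= r' -> continuous_seminorm u -> 0 < e ->
    \forall s \near (0 : R), chart_dom Xi (alpha (t + s) * (alpha t)^-1)%g /\
      u (Xi (alpha (t + s) * (alpha t)^-1)%g) <= e * `|s|.
  move=> tr hu e0.
  have [q hq [N [N' [nN nN' h]]]] := conj_quotient_lipschitz hE hXi Xi_dom Xi_one (mu t) hu.
  have hd := has_derivB (nl t tr) (ml t tr).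
  rewrite subrr in hd; have := hd q hq e e0; move=> hd'.
  apply: filterS2 (filterI (near_right_quotient (mc t tr) nN')
    (near_right_quotient (nc t tr) nN')) hd' => s [Na Nb].
  rewrite add0r addr0 !mulgV subrr subr0 scaler0 subr0 => qs.
  have [] := h (mu t) _ _ (nbhs_singleton nN) Na Nb.
  rewrite (_ : (_ * (_ * mu t))%g = (alpha (t + s) * (alpha t)^-1)%g).
    by move=> d le; split=> //; exact: le_trans le qs.
  by rewrite /alpha !invgM !invgK !mulgA mulVg mul1g.
suff : alpha r' = alpha r by [].
apply: (@chain_local _ (fun s t => alpha t = alpha s)) => //.
  by move=> a b c _ _ _ _ -> ->.
move=> t tr; pose beta s := (alpha s * (alpha t)^-1)%g.
have bc s : r <= s <= r' -> {for s, continuous beta}.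
  by move=> sr; apply: continuous_mulg (ac s sr) _; exact: cst_continuous.
have bt : beta t = 1%g by rewrite /beta mulgV.
have /nbhs_ballP[d /= d0 hd] : \forall s \near t, chart_dom Xi (beta s).
  by apply: (bc t tr); rewrite bt; exact: chart_dom_near.
have bdom s : `|s - t| < d -> chart_dom Xi (beta s).
  by move=> sd; apply: hd; rewrite /ball/= distrC.
have key a b : r <= a -> b <= r' -> a <= b ->
    (forall s, a <= s <= b -> `|s - t| < d) -> Xi (beta b) = Xi (beta a).
  move=> ra br ab abd; apply/eqP; rewrite -subr_eq0; apply/eqP.
  apply: (seminorm_separated hE) => u hu; apply/le_anti; rewrite seminorm_ge0// andbT.
  apply/ler_addgt0Pr => e e0; rewrite add0r.
  have ba1 : 0 < b - a + 1 by rewrite ltr_wpDl// subr_ge0.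
  have ee0 : 0 < e / (b - a + 1) by rewrite divr_gt0.
  apply: (@le_trans _ _ (e / (b - a + 1) * (b - a))); last first.
    by rewrite mulrAC ler_pdivrMr// ler_wpM2l ?(ltW e0)// lerDl.
  apply: (mean_value_seminorm (f := fun s => Xi (beta s)) hu ab) => s sab.
  have sr : r <= s <= r' by case/andP: sab => as_ sb; rewrite (le_trans ra)//= (le_trans sb).
  have ds := bdom s (abd s sab).
  have [|q hq [N1 [N2 [nN1 nN2 _ _ L]]]] := mulg_lipschitz hE hXi hXi hXi Xi_dom ds _ hu.
    by rewrite mul1g.
  have nq := near_right_quotient (ac s sr) nN1.
  apply: filterS2 nq (small s q _ sr hq ee0) => h N1h [_ qh] _.
  have [_] := L _ _ _ _ N1h (nbhs_singleton nN1) (nbhs_singleton nN2) (nbhs_singleton nN2).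
  rewrite mul1g Xi_one subr0 subrr (seminorm0 hq) addr0 /beta mulgA mulgVK.
  by move=> le; exact: le_trans le qh.
have fin s : `|s - t| < d -> Xi (beta s) = Xi (beta t) -> alpha s = alpha t.
  move=> sd e; have : beta s = 1%g.
    by rewrite -(chartK hXi (bdom s sd)) e chartK// bt.
  by rewrite /beta => h; rewrite -[LHS](mulgVK (alpha t)) h mul1g.
exists d => // s /andP[rs sr'] sd; case/andP: (tr) => rt tr'; split=> st.
  apply/esym/fin => //; apply/esym; apply: key => // x /andP[sx xt].
  by apply: le_lt_trans sd; rewrite !ler0_norm ?subr_le0//; lra.
apply: fin => //; apply: key => // x /andP[sx xt].
by apply: le_lt_trans sd; rewrite !ger0_norm ?subr_ge0//; lra.
Qed.

Lemma evolE k (r r' : R) (phi : evol_domain Xi k r r') (mu : R -> G) : r < r' ->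
  log_deriv_of mu phi -> evol phi = (mu r' * (mu r)^-1)%g.
Proof.
move=> rr' hmu; have [nu hnu ->] := evol_curveP phi.
have mint t := log_deriv_of_path hE hXi Xi_dom (t := t) hmu.
have nint t := log_deriv_of_path hE hXi Xi_dom (t := t) hnu.
have qE : ((mu r')^-1 * nu r' = (mu r)^-1 * nu r)%g.
  apply: (@quotient_constant mu nu (lie_path Xi phi) r r' (ltW rr')) => t tr.
  - by have [] := mint t tr.
  - by have [] := nint t tr.
  - by have [] := mint t tr.
  - by have [] := nint t tr.
have -> : (nu r' = mu r' * ((mu r)^-1 * nu r))%g by rewrite -qE mulgA mulgV mul1g.
by rewrite mulgA mulgK.
Qed.

End Uniqueness.
(** * Continuity of the evolution maps implies local mu-convexity *)

Section ContinuousImpliesConvex.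
Context {R : realType} {E : tvsType R} {G : lieGroupType E}.
Hypothesis hE : hausdorff_space E.
Variable Xi : chart G E.
Hypothesis hXi : atlas Xi.
Hypothesis Xi_dom : chart_dom Xi 1%g.
Hypothesis Xi_one : Xi 1%g = 0.

Let quot := chart_mul Xi (inv_chart Xi) Xi.
Let quot_dom := chart_mul_dom Xi (inv_chart Xi) Xi.
Let hXi' := inv_chart_atlas hXi.
Let open_quot_dom : open quot_dom := open_chart_mul_dom hXi hXi' hXi.
Let quot_Ck : Ck_on None quot_dom quot := chart_mul_Ck hXi hXi' hXi.

Let cod0 : chart_cod Xi 0.
Proof. by rewrite -Xi_one; exact: chart_codP. Qed.

Let inv0 : chart_inv Xi 0 = 1%g.
Proof. by rewrite -Xi_one chartK. Qed.

(** The logarithmic derivative at [s] of the ray through [X], the image of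
  [s *: X] under the inverse of [Xi]. *)
Definition ray_log_deriv (X : E) (s : R) : E := dderiv (X, 0) quot (s *: (X, X)).

Lemma ray_quot_dom X (s : R) : chart_cod Xi (s *: X) -> quot_dom (s *: (X, X)).
Proof. by move=> cX; split=> //=; rewrite mulgV. Qed.

Lemma ray_log_deriv_has_deriv X (s : R) : chart_cod Xi (s *: X) ->
  has_deriv (fun h => quot (s *: (X, X) + h *: (X, 0))) 0 (ray_log_deriv X s).
Proof.
move=> cX; apply: ddiff_has_deriv => //.
by apply: (C1_ddiff (k := None) _ isT quot_Ck); exact: ray_quot_dom.
Qed.

Lemma ray_log_deriv_smooth n X :
  smooth n [set s | chart_cod Xi (s *: X)] (ray_log_deriv X).
Proof.
have := smooth_line hE n [:: (X, 0)] 0 (X, X) open_quot_dom quot_Ck.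
rewrite (_ : (fun r => _) = ray_log_deriv X); last by apply/funext => r; rewrite add0r.
by apply: smooth_sub => s /= cs; rewrite add0r; exact: ray_quot_dom.
Qed.

Lemma has_deriv_bound (f : R -> E) t l (u : E -> R) (K : R) : continuous_seminorm u ->
  has_deriv f t l -> (\forall s \near (0 : R), u (f (t + s) - f t) <= K * `|s|) -> u l <= K.
Proof.
move=> hu fl fK; apply/ler_addgt0Pr => e e0.
have : \forall s \near (0 : R), u (s *: l) <= (K + e) * `|s|.
  apply: filterS2 (fl u hu e e0) fK => s h1 h2.
  apply: le_trans (seminorm_le_sub _ (f (t + s) - f t) hu) _.
  by rewrite mulrDl lerD// seminormBC.
move=> /nbhs_ballP[d /= d0 hd].
have d2 : 0 < d / 2 by rewrite divr_gt0.
have := hd (d / 2); rewrite /ball/= sub0r normrN gtr0_norm//.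
rewrite ltr_pdivrMr// ltr_pMr// ltr1n => /(_ isT).
by rewrite (seminormZ _ _ hu) gtr0_norm// mulrC ler_pM2r.
Qed.

(** As the quotient of two equal factors is constant, the logarithmic derivatives
  of short rays are bounded by their directions. *)
Lemma ray_log_deriv_bound (p : E -> R) : continuous_seminorm p ->
  exists2 q : E -> R, continuous_seminorm q & forall X (s : R), q X < 1 ->
    0 <= s <= 1 -> chart_cod Xi (s *: X) /\ p (ray_log_deriv X s) <= q X.
Proof.
move=> hp.
have z0 : quot_dom (0, 0).
  by have := @ray_quot_dom 0 0; rewrite !scaler0; apply.
have [q hq hL] := C1_lipschitz (k := None) hE open_quot_dom isT quot_Ck z0 hp.
have ql := seminorm_inl hq; have qr := seminorm_inr hq.
have hq2 := seminorm_scale (ler0n _ 2) (seminormD ql qr).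
exists (fun x => 2 * (q (x, 0) + q (0, x))) => // X s qX /andP[s0 s1].
have qX0 : q (X, 0) < 2^-1.
  have := seminorm_ge0 X qr; have := qX.
  have : (2 : R) * 2^-1 = 1 by rewrite divff.
  lra.
have zX : q (s *: (X, X)) <= 2^-1.
  rewrite (seminormZ _ _ hq) ger0_norm//.
  apply: (@le_trans _ _ (1 * q (X, X))); first by rewrite ler_wpM2r// seminorm_ge0.
  rewrite mul1r; apply: le_trans (seminorm_pair _ _ hq) _.
  have : (2 : R) * 2^-1 = 1 by rewrite divff.
  lra.
have half1 : (2^-1 : R) < 1 by rewrite invf_lt1// ltr1n.
have sub00 (z : E * E) : z - (0, 0) = z.
  by apply: injective_projections; rewrite /= subr0.
have zX1 : q (s *: (X, X) - (0, 0)) < 1 by rewrite sub00 (le_lt_trans zX).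
have [[[cX _] _] _ _] := hL _ _ zX1 zX1.
split=> //; apply: (@le_trans _ _ (q (X, 0))); last first.
  have := seminorm_ge0 X qr; have := seminorm_ge0 X ql; lra.
apply: (has_deriv_bound hp (ray_log_deriv_has_deriv cX)).
apply: filterS (near0_normlt ltr01) => h h1; rewrite add0r scale0r addr0.
have zh : q (s *: (X, X) + h *: (X, 0) - (0, 0)) < 1.
  rewrite sub00; apply: le_lt_trans (seminorm_add _ _ hq) _.
  rewrite (seminormZ h (X, 0) hq).
  have : `|h| * q (X, 0) <= q (X, 0) by rewrite ler_piMl ?(seminorm_ge0 X ql)// ltW.
  have : (2 : R) * 2^-1 = 1 by rewrite divff.
  lra.
have [_ _] := hL _ _ zh zX1.
by rewrite [_ + h *: _]addrC addrK (seminormZ _ _ hq) mulrC.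
Qed.

(** Smooth motions from the unit to [g], completed at time [T], with logarithmic
  derivative bounded by [K]. *)
Definition reached_by_time (p : E -> R) (K T : R) (g : G) : Prop :=
  exists (mu : R -> G) (phi : R -> E),
    [/\ continuous mu, forall n, smooth n setT phi &
        forall t, has_log_deriv Xi mu t (phi t)] /\
    [/\ forall t, t <= 0 -> mu t = 1%g, forall t, T <= t -> mu t = g,
        forall t, T <= t -> phi t = 0 & forall t, p (phi t) <= K].

Lemma has_log_deriv_cst (g : G) t : has_log_deriv Xi (fun _ => g) t 0.
Proof. exact: has_deriv_cst. Qed.

Lemma reached_unit p (K : R) : continuous_seminorm p -> 0 <= K ->
  reached_by_time p K 0 1%g.
Proof.
move=> hp K0; exists (fun _ => 1%g), (fun _ => 0); split; split => //.
- by move=> t; exact: cst_continuous.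
- by move=> n; exact: smooth_cst.
- by move=> t; exact: has_log_deriv_cst.
- by move=> t; rewrite seminorm0.
Qed.

Section Concatenation.
Variables (step' : R -> R) (C : R).
Hypothesis step_has_deriv : forall t, has_deriv (E := R^o) step t (step' t).
Hypothesis step'_smooth : forall n, smooth (E := R^o) n setT step'.
Hypothesis step'_out : forall t, t <= 0 \/ 1 <= t -> step' t = 0.
Hypothesis step'_le : forall t, `|step' t| <= C.

(** A motion reaching [g] at time [T] is prolonged along the ray through [X],
  run through between the times [T + d] and [T + 2 * d] at the pace of [step];
  near every time only one of the two factors varies. *)
Lemma reached_ray (p : E -> R) (K T d Q : R) X g : continuous_seminorm p ->
  0 <= T -> 0 < d ->
  (forall s, 0 <= s <= 1 -> chart_cod Xi (s *: X) /\ p (ray_log_deriv X s) <= Q) ->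
  C * Q <= K * d -> reached_by_time p K T g ->
  reached_by_time p K (T + 2 * d) (chart_inv Xi X * g)%g.
Proof.
move=> hp T0 d0 hX CQ [mu [phi [[mc ps ml] [mu0 muT phiT phiK]]]].
pose clock t := (t - (T + d)) * d^-1.
pose sg t := step (clock t); pose sg' t := d^-1 * step' (clock t).
have clock_le0 t : t <= T + d -> clock t <= 0.
  by move=> td; rewrite /clock pmulr_lle0 ?invr_gt0// subr_le0.
have clock_has_deriv t : has_deriv (E := R^o) clock t d^-1.
  apply/has_deriv_realP => e e0; near=> s.
  have -> : clock (t + s) - clock t - s * d^-1 = 0 by rewrite /clock; ring.
  by rewrite normr0 mulr_ge0// ltW.
have clock_smooth n : smooth (E := R^o) n setT clock.
  apply: smooth_mul; last exact: smooth_cst.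
  by apply: (@smoothD R R^o); [exact: smooth_id|exact: smooth_cst].
have sg_has_deriv t : has_deriv (E := R^o) sg t (sg' t).
  exact: (@has_deriv_comp R R^o step clock t _ _ (clock_has_deriv t) (step_has_deriv _)).
have sg_smooth n : smooth (E := R^o) n setT sg.
  exact: (@smooth_comp R R^o n setT setT clock step (clock_smooth n) (fun _ _ => I)
    (smooth_step n)).
have sg'_smooth n : smooth (E := R^o) n setT sg'.
  apply: smooth_mul; first exact: smooth_cst.
  exact: (@smooth_comp R R^o n setT setT clock step' (clock_smooth n) (fun _ _ => I)
    (step'_smooth n)).
have sg_cod t : chart_cod Xi (sg t *: X) by have [] := hX (sg t) (step_01 _).
have sg_le t : t <= T + d -> sg t = 0 by move=> /clock_le0; exact: step_le0.
have sg'_le t : t <= T + d -> sg' t = 0.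
  by move=> /clock_le0 h; rewrite /sg' step'_out ?mulr0//; left.
have sg_ge t : T + 2 * d <= t -> sg t = 1.
  move=> td; apply: step_ge1; rewrite /clock ler_pdivlMr//; lra.
have sg'_ge t : T + 2 * d <= t -> sg' t = 0.
  move=> td; rewrite /sg' step'_out ?mulr0//; right.
  by rewrite /clock ler_pdivlMr//; lra.
exists (fun t => chart_inv Xi (sg t *: X) * mu t)%g.
exists (fun t => phi t + sg' t *: ray_log_deriv X (sg t)).
split; split.
- move=> t.
  have ct : {for t, continuous (fun t => chart_inv Xi (sg t *: X))}.
    apply: (@continuous_comp _ _ _ (fun t => sg t *: X) (chart_inv Xi)).
      apply: continuous_scale; last exact: cst_continuous.
      exact: (has_deriv_continuous (sg_has_deriv t)).
    exact: chart_inv_continuous.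
  exact: (continuous_mulg ct (mc t)).
- move=> n; apply: smoothD => //; apply: smooth_scale => //.
  exact: (@smooth_comp R E n setT _ sg _ (sg_smooth n) (fun t _ => sg_cod t)
    (ray_log_deriv_smooth n X)).
- move=> t; case: (ltP t (T + d)) => td.
    rewrite (sg'_le t (ltW td)) scale0r addr0.
    have hn : \forall s \near (0 : R), t + s < T + d.
      apply: ((near_shift t (fun s => s < T + d)).1 _); exact: lt_nbhsl.
    apply: has_deriv_near (ml t); apply: filterS hn => s ts.
    by rewrite add0r (sg_le _ (ltW ts)) (sg_le _ (ltW td)) scale0r inv0 !mul1g.
  have Tt : T < t by apply: lt_le_trans td; rewrite ltrDl.
  rewrite (phiT t (ltW Tt)) add0r.
  pose h s := quot (s *: X, sg t *: X).
  have hh : has_deriv h (sg t) (ray_log_deriv X (sg t)).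
    apply/has_deriv_shift; apply: has_deriv_near (ray_log_deriv_has_deriv (sg_cod t)).
    near=> s; rewrite add0r /h; congr quot.
    by apply: injective_projections; rewrite /= ?scaler0 ?addr0// scalerDl.
  have := (has_deriv_shift _ _ _).1 (has_deriv_comp (sg_has_deriv t) hh).
  have hn : \forall s \near (0 : R), T < t + s.
    apply: ((near_shift t (fun s => T < s)).1 _); exact: lt_nbhsr.
  apply: has_deriv_near; apply: filterS hn => s ts.
  rewrite add0r (muT _ (ltW ts)) (muT _ (ltW Tt)) /h /quot /chart_mul /=.
  by rewrite invgM mulgA mulgK.
- move=> t t0; rewrite (mu0 t t0) mulg1 sg_le ?scale0r ?inv0//.
  by rewrite (le_trans t0)// addr_ge0// ltW.
- move=> t tT; rewrite (sg_ge t tT) scale1r muT//.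
  by apply: le_trans tT; rewrite lerDl mulr_ge0// ltW.
- move=> t tT; rewrite (sg'_ge t tT) scale0r addr0 phiT//.
  by apply: le_trans tT; rewrite lerDl mulr_ge0// ltW.
- move=> t; case: (leP t (T + d)) => td; first by rewrite (sg'_le t td) scale0r addr0.
  rewrite phiT ?add0r; last by apply: le_trans (ltW td); rewrite lerDl ltW.
  have [_ pQ] := hX (sg t) (step_01 _).
  rewrite (seminormZ _ _ hp) /sg' normrM gtr0_norm ?invr_gt0// -mulrA ler_pdivrMl//.
  rewrite [leRHS]mulrC; apply: le_trans CQ; apply: ler_pM => //.
  exact: seminorm_ge0.
Unshelve. all: by end_near. Qed.

Lemma reached_product (p q delta : E -> R) (K : R) (Xs : seq E) :
  continuous_seminorm p -> 0 <= K ->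
  (forall X s, q X < 1 -> 0 <= s <= 1 ->
    chart_cod Xi (s *: X) /\ p (ray_log_deriv X s) <= q X) ->
  (forall X, X \in Xs -> [/\ q X < 1, 0 < delta X & C * q X <= K * delta X]) ->
  reached_by_time p K (\sum_(X <- Xs) 2 * delta X) (\prod_(X <- Xs) chart_inv Xi X)%g.
Proof.
move=> hp K0 hq; elim: Xs => [|X Xs IH] hXs.
  by rewrite !big_nil; exact: reached_unit.
have [qX dX CX] := hXs X (mem_head _ _).
have hXs' Y : Y \in Xs -> [/\ q Y < 1, 0 < delta Y & C * q Y <= K * delta Y].
  by move=> YXs; apply: hXs; rewrite inE YXs orbT.
rewrite !big_cons addrC; apply: (@reached_ray p K _ (delta X) (q X)) => //.
- rewrite big_seq; apply: sumr_ge0 => Y /hXs' [_ dY _].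
  by rewrite mulr_ge0// ltW.
- by move=> s s01; exact: hq.
- exact: IH.
Qed.

End Concatenation.

Lemma Ck_on_infty (F : tvsType R) (U : set F) (f : F -> E) :
  (forall n, Ck_on (Some n) U f) -> Ck_on None U f.
Proof.
move=> h; split=> [vs v x _ Ux|p _].
  by have [fd _] := h (size vs).+1; apply: fd => //; exact: leqnn.
by have [_ fc] := h p; apply: fc; exact: leqnn.
Qed.

(** A smooth motion gives an element of the domain of the evolution map, of any
  class. *)
Lemma evol_domain_of_curve k (mu : R -> G) (phi : R -> E) : continuous mu ->
  (forall n, smooth n setT phi) -> (forall t, has_log_deriv Xi mu t (phi t)) ->
  exists psi : evol_domain Xi k 0 1, evol psi = (mu 1%R * (mu 0%R)^-1)%g /\
    forall t, lie_coord Xi psi t = phi (val t).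
Proof.
move=> mc ps ml.
have pc : continuous phi by move=> t; exact: (smooth_continuous (ps 0%N)).
have mC := C1_curve_of_log_deriv hE hXi Xi_dom Xi_one mc pc ml.
have itvT : is_interval [set: R] by [].
have hlog : log_deriv_of mu (fun t : itv_type 0 1 => right_log_deriv mu (val t)).
  by split=> //; exists setT; split=> //; exact: openT.
have coordE (t : itv_type 0 1) : lie_coord Xi
    (fun t : itv_type 0 1 => right_log_deriv mu (val t)) t = phi (val t).
  exact: (dchart_right_log_deriv hE hXi Xi_dom openT mC I (ml _)).
have hCk : exists2 f, Ck_itv (model_atlas E) k 0 1 f & forall t, lie_coord Xi
    (fun t : itv_type 0 1 => right_log_deriv mu (val t)) t = f (val t).
  exists phi => //; exists setT; split=> //; first exact: openT.
  apply/Ck_curveP; first exact: openT.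
  split=> [t _|_ ->]; first exact: pc.
  rewrite (_ : _ `&` _ = setT); last by apply/seteqP; split.
  have h n : Ck_on (F := R^o) (Some n) setT phi by apply: smooth_Ck_on => //; exact: openT.
  by case: (k) => [n|]; [exact: h|exact: Ck_on_infty].
exists (EvolDomain (ex_intro _ mu hlog) hCk); split=> //.
by apply: (evolE hE hXi Xi_dom Xi_one) => //; exact: ltr01.
Qed.

(** Continuity of the evolution map at the constant curve confines products of
  short chart images, as these are reached by motions with small logarithmic
  derivative: each factor is allotted a time proportional to its length, up to an
  error that accounts for vectors of length zero. *)
Lemma continuous_small_products k (W : set G) : zero_k_continuous Xi k ->
  nbhs 1%g W -> exists2 o : E -> R, continuous_seminorm o &
    forall Xs : seq E, \sum_(X <- Xs) o X <= 1 ->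
      (forall X, X \in Xs -> chart_cod Xi X) /\ W (\prod_(X <- Xs) chart_inv Xi X)%g.
Proof.
move=> hk nW.
have [step' [C [s1 s2 s3 C0 s4]]] := @step_deriv R.
have c1 : continuous (fun _ : R => 1%g : G) by move=> t; exact: cst_continuous.
have [phi0 [ev0 phi0E]] := evol_domain_of_curve k c1 (fun n => smooth_cst n setT 0)
  (fun t => has_log_deriv_cst 1%g t).
have nW0 : nbhs (evol phi0) W by rewrite ev0 mulgV.
have [p [e [hp e0 hW]]] := evol_domain_nbhs ltr01 (hk 0 1 ltr01 phi0 W nW0).
have [q hq hray] := ray_log_deriv_bound hp.
(* The first bound on [lam] makes the motions slow enough for [e]; the second
   forces [q X < 1], so that the rays stay in the chart. *)
pose lam := Num.max (4 * C / e) 2.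
have lam2 : 2 <= lam by rewrite le_max lexx orbT.
have lamC : 4 * C <= lam * e by rewrite -ler_pdivrMr// le_max lexx.
have lam0 : 0 < lam by apply: lt_le_trans lam2.
exists (fun X => lam * q X); first by apply: seminorm_scale => //; exact: ltW.
move=> Xs sum1.
have oge0 X : 0 <= lam * q X by rewrite mulr_ge0 ?(ltW lam0)// seminorm_ge0.
have o1 X : X \in Xs -> lam * q X <= 1.
  move=> XXs; apply: le_trans sum1; rewrite (big_rem X)//= lerDl.
  by apply: sumr_ge0 => Y _.
have q1 X : X \in Xs -> q X < 1.
  move=> /o1 h; have := seminorm_ge0 X hq.
  have : 2 * q X <= lam * q X by rewrite ler_wpM2r// seminorm_ge0.
  lra.
split=> [X XXs|].
  by have [] := hray X 1 (q1 X XXs) _; [rewrite ler01 lexx|rewrite scale1r].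
(* The error [c] keeps the allotted times positive when [q X] vanishes, while
   their sum is at most [1]. *)
pose c : R := ((size Xs).+1)%:R^-1.
have c0 : 0 < c by rewrite invr_gt0 ltr0n.
pose delta X := (lam * q X + c) / 4.
have sumE (s : seq E) : \sum_(X <- s) 2 * delta X =
    (\sum_(X <- s) lam * q X + (size s)%:R * c) / 2.
  elim: s => [|X s IH]; first by rewrite !big_nil mul0r addr0 mul0r.
  by rewrite !big_cons IH /= -natr1 /delta; field.
have T1 : \sum_(X <- Xs) 2 * delta X <= 1.
  rewrite sumE ler_pdivrMr// mul1r.
  have : (size Xs)%:R * c <= 1 by rewrite /c ler_pdivrMr ?ltr0n// mul1r ler_nat.
  lra.
have hXs X : X \in Xs -> [/\ q X < 1, 0 < delta X & C * q X <= e * delta X].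
  move=> XXs; split; first exact: q1.
    by rewrite /delta divr_gt0// ltr_wpDl.
  have h1 : 4 * C * q X <= lam * e * q X by rewrite ler_wpM2r// seminorm_ge0.
  have h2 : 0 <= e * c by rewrite mulr_ge0 ?(ltW e0)// ltW.
  rewrite /delta mulrA ler_pdivlMr// mulrDr; lra.
have [mu [phi [[mc ps ml] [mu0 muT _ phiK]]]] :=
  reached_product s1 s2 s3 s4 hp (ltW e0) hray hXs.
have [psi [evE psiE]] := evol_domain_of_curve k mc ps ml.
rewrite -(muT 1 T1) -[mu 1]mulg1 -[X in (_ * X)%g]invg1 -(mu0 0 (lexx _)) -evE.
by apply: hW => t; rewrite psiE phi0E subr0; exact: phiK.
Qed.

(** Once the partial products are confined, the Lipschitz estimate for the
  multiplication, applied factor by factor, yields the linear bound. *)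
Theorem continuous_convex k : zero_k_continuous Xi k -> locally_mu_convex Xi.
Proof.
move=> hk u hu.
have [|q hq [N1 [N2 [nN1 nN2 _ _ L]]]] := mulg_lipschitz hE hXi hXi hXi Xi_dom Xi_dom _ hu.
  by rewrite mul1g.
have [p hp pN1] := chart_nbhs hXi Xi_dom nN1; rewrite Xi_one in pN1.
have [om hom hoW] := continuous_small_products hk
  (filterI nN2 (chart_dom_near hXi Xi_dom)).
have h2p := seminorm_scale (ler0n _ 2) hp.
have hN := seminormD (seminormD hom h2p) (seminormD hq hu).
exists (fun x => om x + 2 * p x + (q x + u x)).
have ge0 x : [/\ 0 <= om x, 0 <= p x, 0 <= q x & 0 <= u x].
  by split; exact: seminorm_ge0.
pose N x := om x + 2 * p x + (q x + u x).
have N_o x : om x <= N x by have [] := ge0 x; rewrite /N; lra.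
have N_p x : 2 * p x <= N x by have [] := ge0 x; rewrite /N; lra.
have N_q x : q x <= N x by have [] := ge0 x; rewrite /N; lra.
have N_u x : u x <= N x by have [] := ge0 x; rewrite /N; lra.
have N0 x : 0 <= N x by apply: le_trans (N_o x); exact: seminorm_ge0.
have main (Xs : seq E) : \sum_(X <- Xs) N X <= 1 ->
    [/\ forall X, X \in Xs -> chart_cod Xi X, chart_dom Xi (\prod_(X <- Xs) chart_inv Xi X)%g &
        u (Xi (\prod_(X <- Xs) chart_inv Xi X)%g) <= \sum_(X <- Xs) N X].
  have small s : \sum_(X <- s) N X <= 1 -> \sum_(X <- s) om X <= 1.
    by apply: le_trans; apply: ler_sum => X _; exact: N_o.
  move=> le1; have [cods [_ dom]] := hoW Xs (small _ le1); split=> // {cods dom}.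
  elim: Xs le1 => [|X Xs IH]; first by rewrite !big_nil Xi_one seminorm0.
  rewrite !big_cons => le1.
  have X1 : N X <= 1 by apply: le_trans le1; rewrite lerDl sumr_ge0.
  have Xs1 : \sum_(Y <- Xs) N Y <= 1 by apply: le_trans le1; rewrite lerDr.
  have [_ [N2P _]] := hoW Xs (small _ Xs1).
  have pX : p (X - 0) < 1.
    have := seminorm_ge0 X hp; have := le_trans (N_p X) X1; rewrite subr0; lra.
  have [cX N1X] := pN1 X pX.
  have [_] := L _ _ _ _ N1X (nbhs_singleton nN1) N2P N2P.
  rewrite mul1g subrr (seminorm0 hq) addr0 Xi_one subr0 chart_invK// => lip.
  apply: le_trans (seminorm_le_sub _ (Xi (\prod_(Y <- Xs) chart_inv Xi Y)%g) hu) _.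
  by rewrite addrC lerD ?IH//; exact: le_trans lip (N_q X).
split=> // n X n0; have := main [seq X i | i <- index_enum 'I_n].
rewrite !big_map => h /h [cods dom le]; split=> // i.
by apply: cods; apply: map_f; exact: mem_index_enum.
Qed.

End ContinuousImpliesConvex.

Theorem mainTheorem2 (R : realType) (E : tvsType R) (hE : hausdorff_space E)
    (G : lieGroupType E) (Xi : chart G E) (hXi : atlas Xi)
    (Xi_dom : chart_dom Xi 1%g) (Xi_one : Xi 1%g = 0)
    (Xi_convex : convex_set (chart_cod Xi)) :
  [<-> zero_k_continuous Xi (Some 0%N);
       locally_mu_convex Xi;
       zero_k_continuous Xi None].
Proof.
tfae.
- exact: continuous_convex.
- exact: convex_continuous.
- by move=> /(continuous_convex hE hXi Xi_dom Xi_one); exact: convex_continuous.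
Qed.
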